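(* Let $m\ge1$, $d\ge0$, $k=\mathbb{F}_q$ and $R=R_{2,2m}=k[[X,Y]]/(Y(Y-X^m))$, with normalization $\widetilde{R}$. With $t:=q^{-s}$, $$\nu^R_{\widetilde{R}^d}(s)=\sum_{\mu\subseteq(m^d)}g^{(m^d)}_\mu(q)\,\frac{(q^{-1};q^{-1})_d}{(q^{-1};q^{-1})_{d-\mu'_1}}\,(q^dt)^{|\mu|}.$$
   Context: $\widetilde{R}\simeq k[[T_1]]\times k[[T_2]]$. $\zeta^R_{\widetilde{R}^d}(s)=\sum_N|\widetilde{R}^d/N|^{-s}$ is the sum over finite-index $R$-submodules $N\subseteq\widetilde{R}^d$, $\zeta^{\widetilde{R}}_{\widetilde{R}^d}(s)$ is the same sum over finite-index $\widetilde{R}$-submodules, and $\nu^R_{\widetilde{R}^d}(s)=\zeta^R_{\widetilde{R}^d}(s)/\zeta^{\widetilde{R}}_{\widetilde{R}^d}(s)$. $(a;q)_n=\prod_{j=0}^{n-1}(1-aq^j)$. For a partition $\mu$: $|\mu|$ is its size, $\mu'$ its conjugate (so $\mu'_1$ is the number of parts), $\mu\subseteq\lambda$ is containment of Young diagrams, and $(m^d)=(m,\dots,m)$ ($d$ parts). The skew Hall polynomial $g^\lambda_\mu(q)$ is the number of submodules of type $\mu$ in a fixed module of type $\lambda$ over a DVR $(V,\pi)$ with residue field $\mathbb{F}_q$ (type $\lambda$ means isomorphic to $\bigoplus_iV/\pi^{\lambda_i}V$). Explicitly, $$g^\lambda_\mu(q)=q^{\sum_{i\ge1}\mu'_i(\lambda'_i-\mu'_i)}\prod_{i\ge1}\genfrac{[}{]}{0pt}{}{\lambda'_i-\mu'_{i+1}}{\lambda'_i-\mu'_i}_{q^{-1}},\qquad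 \genfrac{[}{]}{0pt}{}{n}{k}_q=\frac{(q;q)_n}{(q;q)_k(q;q)_{n-k}}.$$ *)

(* Defs.v *)
From HB Require Import structures.
From mathcomp Require Import all_boot all_order all_algebra finmap.
From mathcomp Require Import complex.
From mathcomp Require Import all_classical all_reals all_analysis.

Set Implicit Arguments.
Unset Strict Implicit.
Unset Printing Implicit Defensive.

Import Order.TTheory GRing.Theory Num.Theory.

Local Open Scope classical_set_scope.
Local Open Scope ring_scope.

(* A[[X]] over a commutative ring A; iterating the construction gives
   A[[X, Y]] as A[[X]][[Y]]. *)
Record fps (A : comNzRingType) := Fps { fcoef : nat -> A }.

Reserved Notation "{ 'fps' A }" (format "{ 'fps'  A }").
Notation "{ 'fps' A }" := (fps A) : type_scope.

HB.instance Definition _ (A : comNzRingType) := gen_eqMixin {fps A}.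
HB.instance Definition _ (A : comNzRingType) := gen_choiceMixin {fps A}.

Section PowerSeries.
Variable A : comNzRingType.
Implicit Types f g h : {fps A}.

Lemma fpsP f g : fcoef f =1 fcoef g -> f = g.
Proof. by case: f g => [f] [g] /= /funext ->. Qed.

Definition fps_zero : {fps A} := Fps (fun=> 0).
Definition fps_opp f : {fps A} := Fps (fun n => - fcoef f n).
Definition fps_add f g : {fps A} := Fps (fun n => fcoef f n + fcoef g n).
Definition fpsC (a : A) : {fps A} := Fps (fun n => if n == 0%N then a else 0).
Definition fpsX : {fps A} := Fps (fun n => (n == 1%N)%:R).
Definition fps_mul f g : {fps A} :=
  Fps (fun n => \sum_(i < n.+1) fcoef f i * fcoef g (n - i)%N).

Fact fps_addA : associative fps_add.
Proof. by move=> f g h; apply: fpsP => n /=; rewrite addrA. Qed.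
Fact fps_addC : commutative fps_add.
Proof. by move=> f g; apply: fpsP => n /=; rewrite addrC. Qed.
Fact fps_add0 : left_id fps_zero fps_add.
Proof. by move=> f; apply: fpsP => n /=; rewrite add0r. Qed.
Fact fps_addN : left_inverse fps_zero fps_opp fps_add.
Proof. by move=> f; apply: fpsP => n /=; rewrite addNr. Qed.

HB.instance Definition _ :=
  GRing.isZmodule.Build {fps A} fps_addA fps_addC fps_add0 fps_addN.

(* Truncation to a polynomial, used to import the ring axioms of {poly A}. *)
Definition fps_trunc N f : {poly A} := \poly_(i < N) fcoef f i.

Lemma fcoef_mulE N n f g : (n < N)%N ->
  fcoef (fps_mul f g) n = (fps_trunc N f * fps_trunc N g)`_n.
Proof.
move=> nN; rewrite coefM /=; apply: eq_bigr => i _.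
have iN : (i < N)%N by apply: leq_ltn_trans nN; rewrite -ltnS.
by rewrite !coef_poly iN (leq_ltn_trans (leq_subr _ _) nN).
Qed.

Fact fps_mulC : commutative fps_mul.
Proof. by move=> f g; apply: fpsP => n; rewrite !(@fcoef_mulE n.+1)// mulrC. Qed.

Fact fps_mulA : associative fps_mul.
Proof.
move=> f g h; apply: fpsP => n.
pose tf := fps_trunc n.+1 f; pose tg := fps_trunc n.+1 g.
pose th := fps_trunc n.+1 h.
transitivity ((tf * (tg * th))`_n).
  rewrite coefM /=; apply: eq_bigr => i _; rewrite coef_poly ltn_ord.
  congr (_ * _); exact: (@fcoef_mulE n.+1 (n - i)%N g h (leq_subr _ _)).
rewrite mulrA coefM /=; apply: eq_bigr => i _.
rewrite coef_poly ltnS leq_subr; congr (_ * _).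
by rewrite -(@fcoef_mulE n.+1 i f g (ltn_ord i)).
Qed.

Fact fps_mul1 : left_id (fpsC 1) fps_mul.
Proof.
move=> f; apply: fpsP => n /=.
by rewrite big_ord_recl /= mul1r subn0 big1 ?addr0// => i _; rewrite mul0r.
Qed.

Fact fps_mulDl : left_distributive fps_mul fps_add.
Proof.
move=> f g h; apply: fpsP => n /=; rewrite -big_split /=.
by apply: eq_bigr => i _; rewrite mulrDl.
Qed.

Fact fps_1neq0 : fpsC 1 != 0 :> {fps A}.
Proof.
by apply/eqP => /(congr1 (fun f => fcoef f 0%N)) /= /eqP; rewrite oner_eq0.
Qed.

HB.instance Definition _ := GRing.Zmodule_isComNzRing.Build {fps A}
  fps_mulA fps_mulC fps_mul1 fps_mulDl fps_1neq0.

End PowerSeries.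

Arguments fpsX {A}.

(* In k[[X]][[Y]] the outer variable is Y, and X is the constant fpsC fpsX. *)
Section Singularity.
Variables (k : finFieldType) (m : nat).

Definition singX : {fps {fps k}} := fpsC fpsX.
Definition singY : {fps {fps k}} := fpsX.
Definition sing_rel : {fps {fps k}} := singY * (singY - singX ^+ m).

Definition sing_ideal : {pred {fps {fps k}}} :=
  fun f => `[< exists g, f = g * sing_rel >].

Fact sing_ideal_closed : idealr_closed sing_ideal.
Proof.
split.
- by apply/asboolP; exists 0; rewrite mul0r.
- apply/negP => /asboolP[g /(congr1 (fun f => fcoef f 0%N))] /=.
  rewrite big_ord_recl big_ord0 /= big_ord_recl big_ord0 /= mul0r !addr0 mulr0.
  by move=> /eqP; rewrite oner_eq0.
- move=> a u v /asboolP[g ->] /asboolP[h ->]; apply/asboolP.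
  by exists (a * g + h); rewrite mulrDl mulrA.
Qed.

HB.instance Definition _ :=
  isIdealr.Build {fps {fps k}} sing_ideal sing_ideal_closed.

(* k[[X, Y]] / (Y (Y - X^m)) *)
Definition R_2_2m : comNzRingType := {ideal_quot sing_ideal}.

End Singularity.

(* f exhibits Q as the localization of A at its non-zero-divisors *)
Definition is_total_fraction_ring (A Q : comNzRingType)
    (f : {rmorphism A -> Q}) : Prop :=
  [/\ injective f,
      forall b : A, GRing.lreg b -> exists c : Q, f b * c = 1 &
      forall x : Q, exists a b : A, GRing.lreg b /\ x * f b = f a].

(* iota exhibits B as the integral closure of A in its total ring of
   fractions *)
Definition is_normalization (A B : comNzRingType)
    (iota : {rmorphism A -> B}) : Prop :=
  exists (Q : comNzRingType) (j : {rmorphism B -> Q}),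
    [/\ is_total_fraction_ring (j \o iota), injective j &
        forall x : Q, integralOver (j \o iota) x <-> exists y : B, j y = x].

Section Zeta.
Variable R : realType.

(* a ^ z for a > 0 *)
Definition cpow (a : R) (z : R[i]) : R[i] :=
  ((expR (complex.Re z * ln a) * cos (complex.Im z * ln a))
    +i* (expR (complex.Re z * ln a) * sin (complex.Im z * ln a)))%C.

(* Unordered sums; the values are meaningful for absolutely summable families,
   and the library's summable is absolute summability. *)
Definition rsum (T : choiceType) (D : set T) (f : T -> R) : R :=
  fine (esum D (EFin \o f)^\+%E) - fine (esum D (EFin \o f)^\-%E).

Definition csum (T : choiceType) (D : set T) (f : T -> R[i]) : R[i] :=
  (rsum D (fun x => complex.Re (f x)) +i* rsum D (fun x => complex.Im (f x)))%C.

Definition csummable (T : choiceType) (D : set T) (f : T -> R[i]) : Prop :=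
  summable D (fun x => (Normc.normc (f x))%:E).

Variables (A B : comNzRingType) (iota : A -> B) (d : nat).

(* A-submodules of B^d, where A acts through iota *)
Definition is_submodule (N : set 'rV[B]_d) : Prop :=
  [/\ N 0, forall u v, N u -> N v -> N (u + v) &
      forall a v, N v -> N (iota a *: v)].

Definition cosets (N : set 'rV[B]_d) : set (set 'rV[B]_d) :=
  range (fun v => [set w | N (w - v)]).

Definition subm_index (N : set 'rV[B]_d) : nat := #|` fset_set (cosets N)|%fset.

Definition finite_index_submodules : set (set 'rV[B]_d) :=
  [set N | is_submodule N /\ finite_set (cosets N)].

Definition zeta_term (s : R[i]) (N : set 'rV[B]_d) : R[i] :=
  cpow (subm_index N)%:R (- s).

Definition zeta_cvg (s : R[i]) : Prop :=
  csummable finite_index_submodules (zeta_term s).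

Definition zeta (s : R[i]) : R[i] :=
  csum finite_index_submodules (zeta_term s).

End Zeta.

Definition nu (R : realType) (A B : comNzRingType) (iota : A -> B) (d : nat)
    (s : R[i]) : R[i] :=
  zeta iota d s / zeta (idfun : B -> B) d s.

(* Partitions are weakly decreasing sequences of positive integers. *)
Definition is_partition (mu : seq nat) : bool :=
  sorted geq mu && (0%N \notin mu).

(* the i-th part mu'_i of the conjugate partition, for i >= 1 *)
Definition conj_part (mu : seq nat) (i : nat) : nat :=
  count (fun x => (i <= x)%N) mu.

Definition contained (mu lam : seq nat) : Prop :=
  forall i, (nth 0 mu i <= nth 0 lam i)%N.

Section QSeries.
Variable F : fieldType.

Definition qpoch (a q : F) (n : nat) : F := \prod_(j < n) (1 - a * q ^+ j).

Definition qbinom (q : F) (n l : nat) : F :=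
  qpoch q q n / (qpoch q q l * qpoch q q (n - l)%N).

(* The number of submodules of type mu in a module of type lam over a DVR with
   residue field of cardinality q, in closed form. For mu contained in lam, the
   factors and exponents with i > lam_1 are trivial, which makes the product
   over i >= 1 finite. *)
Definition skew_hall (lam mu : seq nat) (q : F) : F :=
  q ^+ (\sum_(1 <= i < (head 0%N lam).+1)
          conj_part mu i * (conj_part lam i - conj_part mu i))%N
  * \prod_(1 <= i < (head 0%N lam).+1)
      qbinom q^-1 (conj_part lam i - conj_part mu i.+1)%N
                  (conj_part lam i - conj_part mu i)%N.

End QSeries.

(* Main.v *)
Require Import Defs.
From HB Require Import structures.
From mathcomp Require Import all_boot all_order all_algebra finmap.
From mathcomp Require Import complex.
From mathcomp Require Import all_classical all_reals all_analysis.
From mathcomp Require Import ring lra zify.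

Set Implicit Arguments.
Unset Strict Implicit.
Unset Printing Implicit Defensive.

Import Order.TTheory GRing.Theory Num.Theory.

Local Open Scope classical_set_scope.
Local Open Scope ring_scope.

(** Write S = k[[X]] and q for the cardinality of k. In the total ring of
    fractions of A = k[[X, Y]] / (Y (Y - X^m)) the element e = Y / X^m is
    idempotent, so it lies in the normalization B; hence B is the product of
    two copies of S, the components along 1 - e and e, and A is the subring of
    pairs congruent modulo X^m (normalization_split).

    An A-submodule N of finite index in B^d generates a B-lattice L. Every ideal
    of finite index of B is principal, so L is free, and a basis of L carries N
    to an A-submodule that generates B^d (esum_by_span). As indices multiply,
    the zeta function over A is the zeta function over B times the sum of
    [B^d : N]^(-s) over the A-submodules N that generate B^d. That sum is
    finite: such an N contains X^m B^d.

    To count these N, write B^d = S^d x S^d and let K be the set of u with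
    (u, 0) in N. Since N generates B^d, both projections of N are onto, so N is
    the same as K together with a surjection from S^d to S^d / K, and N and K
    have the same index (esum_spanning). By Nakayama's lemma the number of
    surjections depends only on the index of K and on the dimension of
    S^d / (K + X S^d). The lattices K containing X^m S^d are counted by their
    type mu, a partition in the box (m^d): passing from K to the colon (K : X)
    removes the first column of mu, and the lattices over a given (K : X)
    correspond to the subspaces of k^d that avoid a given subspace
    (esum_bounded_step). The product of the resulting counts is the skew Hall
    polynomial (type_countE).

    The zeta function over B is computed in the same way, by induction on d: a
    lattice of rank d + 1 consists of an ideal, a lattice L of rank d and a
    class modulo L (esum_latticesS). This multiplies the value of the rank d
    zeta function at s - 1 by (1 - q^(-s))^(-2), which gives convergence for
    Re s > d - 1 and shows that the function vanishes nowhere in its domain of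
    convergence.

    All these identities are proved for sums with values in [0, +oo] of an
    arbitrary nonnegative function w of the index, so that no summability has
    to be discussed while the families are rearranged. The complex sums follow
    by applying them to the positive and negative parts of the real and
    imaginary parts of n^(-s), through the extension cext of a positive
    functional to complex functions. *)

(** * Finite-index subgroups and coset representatives *)

Section Transversals.
Variable V : zmodType.
Implicit Types L M N : set V.

Definition subgroup N : Prop :=
  [/\ N 0, forall u v, N u -> N v -> N (u + v) & forall u, N u -> N (- u)].

Lemma subgroupB N u v : subgroup N -> N u -> N v -> N (u - v).
Proof. by case=> _ ND NN Nu Nv; apply: ND => //; apply: NN. Qed.

Lemma subgroup_subr N u v : subgroup N -> N v -> N (u - v) -> N u.
Proof. by case=> _ ND NN Nv Nuv; rewrite -(subrK v u); apply: ND. Qed.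

Lemma subgroup_sym N u v : subgroup N -> N (u - v) -> N (v - u).
Proof. by case=> _ _ NN /NN; rewrite opprB. Qed.

Lemma subgroup_trans N u v w :
  subgroup N -> N (u - v) -> N (v - w) -> N (u - w).
Proof. by case=> _ ND _ Nuv /(ND _ _ Nuv); rewrite addrA subrK. Qed.

Lemma subgroupT : subgroup setT. Proof. by []. Qed.

(** The elements r j of L represent the classes modulo N of all elements of L,
    each class once. *)
Definition coset_reps L N (J : finType) (r : J -> V) : Prop :=
  [/\ forall j, L (r j),
      forall v, L v -> exists j, N (v - r j) &
      forall i j, N (r i - r j) -> i = j].

Definition coset N v : set V := [set w | N (w - v)].

Definition finite_index L N : Prop := finite_set [set coset N v | v in L].

Lemma coset_eqP N u v : subgroup N -> coset N u = coset N v <-> N (u - v).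
Proof.
move=> sN; split=> [|Nuv].
  by move=> /seteqP[/(_ u) + _]; rewrite /coset /= subrr; apply; case: sN.
apply/seteqP; split=> w /= Nw.
  by apply: subgroup_trans Nuv.
by apply: (subgroup_trans sN Nw); apply: subgroup_sym.
Qed.

Lemma cover_finite_index L N (J : finType) (c : J -> V) :
  subgroup N -> (forall v, L v -> exists j, N (v - c j)) -> finite_index L N.
Proof.
move=> sN Lc.
apply: (@sub_finite_set _ _ [set coset N (c j) | j in [set: J]]).
  move=> _ [v /Lc[j Nj]] <-; exists j => //.
  by apply/coset_eqP => //; apply: subgroup_sym.
exact: finite_image.
Qed.

Lemma coset_reps_finite_index L N (J : finType) (r : J -> V) :
  subgroup N -> coset_reps L N r -> finite_index L N.
Proof. by move=> sN [_ Lr _]; apply: cover_finite_index Lr. Qed.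

Lemma finite_index_coset_reps L N :
  subgroup N -> finite_index L N ->
  exists r : 'I_#|` fset_set [set coset N v | v in L]|%fset -> V,
    coset_reps L N r.
Proof.
move=> sN finN; set F := fset_set _.
have inF (C : F) : exists2 v, L v & coset N v = val C.
  have := fsvalP C; rewrite in_fset_set // => /set_mem [v Lv Ev].
  by exists v.
have inF' (C : F) : exists v, L v /\ coset N v = val C.
  by have [v] := inF C; exists v.
have [r rP] := choice inF'.
have eF : #|` F|%fset = #|{: F}| by rewrite cardfE.
exists (fun i => r (enum_val (cast_ord eF i))); split.
- by move=> j; have [] := rP (enum_val (cast_ord eF j)).
- move=> v Lv.
  have vF : coset N v \in F by rewrite in_fset_set //; apply/mem_set; exists v.
  exists (cast_ord (esym eF) (enum_rank [` vF]%fset)).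
  rewrite cast_ordKV enum_rankK; apply/coset_eqP => //.
  by have [_ ->] := rP [` vF]%fset.
- move=> i j /(coset_eqP _ _ sN).
  have [_ ->] := rP (enum_val (cast_ord eF i)).
  have [_ ->] := rP (enum_val (cast_ord eF j)).
  by move=> /val_inj/enum_val_inj/cast_ord_inj.
Qed.

Lemma coset_reps_card L N (J : finType) (r : J -> V) :
  subgroup N -> coset_reps L N r ->
  #|` fset_set [set coset N v | v in L]|%fset = #|J|.
Proof.
move=> sN [Lr rE rU].
have -> : [set coset N v | v in L] = [set` [fset coset N (r j) | j : J]%fset].
  apply/seteqP; split=> [_ [v Lv] <-|C].
    have [j Nj] := rE v Lv; apply/imfsetP; exists j => //.
    by apply/coset_eqP.
  by move=> /imfsetP[j _ ->]; exists (r j).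
rewrite set_fsetK card_imfset /=; first by rewrite cardE enumT.
by move=> i j /(coset_eqP _ _ sN)/rU.
Qed.

(** Indices multiply along a chain: representatives of the coarse quotient
    added to representatives of the fine one. *)
Lemma coset_reps_chain L M N (I J : finType) (s : I -> V) (r : J -> V) :
  subgroup L -> subgroup M -> subgroup N -> N `<=` M -> M `<=` L ->
  coset_reps L M s -> coset_reps M N r ->
  coset_reps L N (fun ij : I * J => s ij.1 + r ij.2).
Proof.
move=> sL sM sN NM ML [Ls sE sU] [Mr rE rU]; split.
- by move=> [i j] /=; case: sL => _ LD _; apply: LD => //; apply: ML.
- move=> v Lv; have [i Mi] := sE v Lv; have [j Nj] := rE _ Mi.
  by exists (i, j); rewrite /= opprD addrA.
- move=> [i j] [i' j'] /=; rewrite opprD addrACA => Nij.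
  have eii : i = i'.
    apply: sU.
    by have := subgroupB sM (NM _ Nij) (subgroupB sM (Mr j) (Mr j')); rewrite addrK.
  by rewrite eii subrr add0r in Nij *; congr (_, _); apply: rU.
Qed.

Lemma finite_indexW M N : subgroup M -> subgroup N -> N `<=` M ->
  finite_index setT N -> finite_index setT M.
Proof.
move=> sM sN NM /(finite_index_coset_reps sN)[r [_ rE _]].
apply: (cover_finite_index (c := r)) => // v _.
by have [j /NM] := rE v I; exists j.
Qed.

End Transversals.

Lemma coset_reps_image (U V : zmodType) (phi : {additive U -> V})
    (L N : set U) (J : finType) (r : J -> U) :
  injective phi -> coset_reps L N r ->
  coset_reps (phi @` L) (phi @` N) (phi \o r).
Proof.
move=> phiI [Lr rE rU]; split=> [j|_ [v Lv <-]|i j] /=.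
- by exists (r j).
- by have [j Nj] := rE v Lv; exists j, (v - r j); rewrite ?raddfB.
- by rewrite -raddfB => -[v Nv /phiI vE]; apply: rU; rewrite -vE.
Qed.

Lemma subgroup_image (U V : zmodType) (phi : {additive U -> V}) (N : set U) :
  subgroup N -> subgroup (phi @` N).
Proof.
move=> [N0 ND NN]; split.
- by exists 0; rewrite ?raddf0.
- by move=> _ _ [u Nu <-] [v Nv <-]; exists (u + v); rewrite ?raddfD //; apply: ND.
- by move=> _ [u Nu <-]; exists (- u); rewrite ?raddfN //; apply: NN.
Qed.

Lemma subgroup_preimage (U V : zmodType) (phi : {additive U -> V}) (N : set V) :
  subgroup N -> subgroup (phi @^-1` N).
Proof.
move=> [N0 ND NN]; split=> [|u v|u] /=; rewrite ?raddf0 ?raddfD ?raddfN //.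
- exact: ND.
- exact: NN.
Qed.

(** The finitely many classes of V / N that are met by phi give
    representatives for U / M. *)
Lemma finite_index_preimage (U V : zmodType) (phi : {additive U -> V})
    (N : set V) (M : set U) :
  subgroup N -> subgroup M -> phi @^-1` N `<=` M ->
  finite_index setT N -> finite_index setT M.
Proof.
move=> sN sM NM /(finite_index_coset_reps sN)[r [_ rE _]].
pose P j u := N (phi u - r j).
have Pc j : exists c, (exists u, P j u) -> P j c.
  have [[u Pu]|nP] := pselect (exists u, P j u); first by exists u.
  by exists 0.
have [c cP] := choice Pc.
apply: (cover_finite_index (c := c)) => // u _.
have [j Nj] := rE (phi u) I; exists j; apply: NM; rewrite /= raddfB.
have /cP Pj : exists u, P j u by exists u.
by apply: (subgroup_trans sN Nj); apply: subgroup_sym.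
Qed.

Lemma cosetsE (B : comNzRingType) d (N : set 'rV[B]_d) :
  cosets N = [set coset N v | v in setT].
Proof. by []. Qed.

Lemma subm_index_coset_reps (B : comNzRingType) d (N : set 'rV[B]_d)
    (J : finType) (r : J -> 'rV[B]_d) :
  subgroup N -> coset_reps setT N r -> subm_index N = #|J|.
Proof. by move=> sN rT; rewrite /subm_index cosetsE (coset_reps_card sN rT). Qed.

Lemma subm_indexP (B : comNzRingType) d (N : set 'rV[B]_d) :
  subgroup N -> finite_set (cosets N) ->
  exists r : 'I_(subm_index N) -> 'rV[B]_d, coset_reps setT N r.
Proof. by move=> sN; apply: finite_index_coset_reps. Qed.

Lemma subm_index_gt0 (B : comNzRingType) d (N : set 'rV[B]_d) :
  subgroup N -> finite_set (cosets N) -> (0 < subm_index N)%N.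
Proof.
move=> sN /(subm_indexP sN)[r [_ /(_ 0 I)[j _] _]].
by apply: leq_ltn_trans (ltn_ord j).
Qed.

(** * Unordered sums of nonnegative terms *)

Section Esum.
Variable R : realType.
Local Open Scope ereal_scope.

Lemma esum_fibre (T T' : choiceType) (D : set T) (E : set T') (p : T -> T')
    (f : T -> \bar R) :
  (forall x, D x -> E (p x)) -> (forall x, D x -> 0 <= f x) ->
  \esum_(x in D) f x =
  \esum_(y in E) \esum_(x in D `&` p @^-1` [set y]) f x.
Proof.
move=> DE f0; rewrite esum_esum; last by move=> y x _ [/f0].
rewrite (reindex_esum D _ (fun x => (p x, x))) //; split.
- by move=> x Dx /=; split; [apply: DE|].
- by move=> x y _ _ [].
- by move=> [y x] /= [_ [Dx <-]]; exists x.
Qed.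

Lemma esum_finType (J : finType) (f : J -> \bar R) :
  (forall j, 0 <= f j) -> \esum_(j in [set: J]) f j = \sum_(j : J) f j.
Proof.
move=> f0; rewrite esum_fset //; last exact: finite_finset.
rewrite [RHS]fsbig_seq ?index_enum_uniq //; apply: eq_fsbigl.
by apply/seteqP; split=> j //= _; rewrite mem_index_enum.
Qed.

Lemma esum_cst_bij (T : choiceType) (J : finType) (D : set T) (r : J -> T)
    (f : T -> \bar R) (c : \bar R) :
  set_bij setT D r -> 0 <= c -> (forall x, D x -> f x = c) ->
  \esum_(x in D) f x = #|J|%:R%:E * c.
Proof.
move=> rD c0 fc; rewrite (reindex_esum _ _ _ _ rD).
have rj j : f (r j) = c by apply: fc; case: rD => + _ _; apply.
rewrite esum_finType; last by move=> j; rewrite rj.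
under eq_bigr do rewrite rj.
rewrite big_const; elim: #|J| => [|n IHn] /=; first by rewrite mul0e.
by rewrite IHn -natr1 EFinD ge0_muleDl ?lee_fin // mul1e addeC.
Qed.

Lemma esum_cst_finset (T : choiceType) (J : finType) (P : {set J}) (D : set T)
    (r : J -> T) (f : T -> \bar R) (c : \bar R) :
  set_bij [set` P] D r -> 0 <= c -> (forall x, D x -> f x = c) ->
  \esum_(x in D) f x = #|P|%:R%:E * c.
Proof.
move=> [rD rI rS] c0 fc; have -> : #|P| = #|'I_#|P| | by rewrite card_ord.
apply: (esum_cst_bij (r := fun i => r (enum_val (A := mem P) i))) => //; split.
- by move=> i _; apply: rD; apply: enum_valP.
- by move=> i j _ _ /rI E; apply: enum_val_inj; apply: E; apply/mem_set/enum_valP.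
- move=> x /rS[j jP <-]; exists (enum_rank_in jP j) => //.
  by rewrite enum_rankK_in.
Qed.

Lemma esumZl (T : choiceType) (D : set T) (c : R) (f : T -> \bar R) :
  (0 <= c)%R -> (forall x, 0 <= f x) ->
  \esum_(x in D) (c%:E * f x) = c%:E * \esum_(x in D) f x.
Proof.
have le (b : R) (g : T -> \bar R) : (0 <= b)%R -> (forall x, 0 <= g x) ->
    \esum_(x in D) (b%:E * g x) <= b%:E * \esum_(x in D) g x.
  move=> b0 g0; apply: ge_ereal_sup => _ [X XD <-].
  rewrite -ge0_mule_fsumr //; apply: lee_wpmul2l; first by rewrite lee_fin.
  by apply: ereal_sup_ubound; exists X.
move=> c0 f0; have [->|cN0] := eqVneq c 0%R.
  by rewrite mul0e esum1 // => x _; rewrite mul0e.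
apply/eqP; rewrite eq_le le //=.
have {1}-> : \esum_(x in D) f x = \esum_(x in D) (c^-1%:E * (c%:E * f x)).
  by apply: eq_esum => x _; rewrite muleA -EFinM mulVf // mul1e.
apply: le_trans (lee_wpmul2l _ (le _ _ _ _)) _; rewrite ?lee_fin ?invr_ge0 //.
  by move=> x; rewrite mule_ge0 // lee_fin.
by rewrite muleA -EFinM mulfV // mul1e.
Qed.

End Esum.

(** * Lattices over a ring whose finite-index ideals are principal *)

Lemma submodule_subgroup (A B : comNzRingType) (iota : {rmorphism A -> B}) d
    (N : set 'rV[B]_d) : is_submodule iota N -> subgroup N.
Proof.
move=> [N0 ND NZ]; split=> // u Nu.
by rewrite -scaleN1r -(rmorph1 iota) -rmorphN; apply: NZ.
Qed.

Section PrincipalIdeals.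
Variable B : comNzRingType.

Definition pideal (b : B) : set B := [set a * b | a in setT].

Lemma pideal_subgroup b : subgroup (pideal b).
Proof.
split=> [|_ _ [a _ <-] [c _ <-]|_ [a _ <-]].
- by exists 0; rewrite ?mul0r.
- by exists (a + c); rewrite ?mulrDl.
- by exists (- a); rewrite ?mulNr.
Qed.

(** A product of discrete valuation rings with finite residue fields has such a
    system: p runs through the products of powers of the uniformizers. It is
    all that the structure of lattices over B depends on. *)
Record principal_system (J : choiceType) (p : J -> B) (n : J -> nat) : Prop :=
  PrincipalSystem {
    ps_regular : forall j b, b * p j = 0 -> b = 0;
    ps_index : forall j, exists r : 'I_(n j) -> B,
        coset_reps setT (pideal (p j)) r;
    ps_ideal : forall I : set B, subgroup I -> (forall a b, I b -> I (a * b)) ->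
        finite_index setT I -> exists j, I = pideal (p j);
    ps_inj : forall i j, pideal (p i) = pideal (p j) -> i = j }.

Variables (J : choiceType) (p : J -> B) (n : J -> nat).
Hypothesis ps : principal_system p n.

Local Notation lattices d := (@finite_index_submodules B B idfun d).

Lemma lattice_subgroup d (L : set 'rV[B]_d) : lattices d L -> subgroup L.
Proof. by move=> [sL _]; apply: (@submodule_subgroup B B idfun). Qed.

Section Glue.
Variable d : nat.
Implicit Types (v : 'rV[B]_(1 + d)) (w : 'rV[B]_d).

(** A lattice is taken apart into the ideal of first coordinates and the
    lattice of the vectors with first coordinate 0. *)
Definition leading (L : set 'rV[B]_(1 + d)) : set B := [set v 0 0 | v in L].

Definition tail (L : set 'rV[B]_(1 + d)) : set 'rV[B]_d :=
  [set w | L (row_mx 0 w)].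

(** The lattice generated by 0 x L' and by the vector (p j, w). *)
Definition glue j (L' : set 'rV[B]_d) w : set 'rV[B]_(1 + d) :=
  [set v : 'rV_(1 + d) | exists c, v 0 0 = c * p j /\ L' (rsubmx v - c *: w)].

Lemma row_mx_head (c : B) w : row_mx c%:M w 0 0 = c.
Proof.
have -> : (0 : 'I_(1 + d)) = lshift d 0 by apply: val_inj.
by rewrite row_mxEl mxE eqxx.
Qed.

Lemma head_row_mx v : v = row_mx (v 0 0)%:M (rsubmx v).
Proof.
rewrite -[LHS]hsubmxK; congr row_mx; apply/matrixP => i j.
by rewrite !ord1 !mxE eqxx mulr1n; congr (v _ _); apply: val_inj.
Qed.

Lemma row_mx0_head w : (row_mx 0 w : 'rV[B]_(1 + d)) 0 0 = 0.
Proof.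
have -> : (0 : 'I_(1 + d)) = lshift d 0 by apply: val_inj.
by rewrite row_mxEl mxE.
Qed.

Lemma tail_lattice L : lattices (1 + d) L -> lattices d (tail L).
Proof.
move=> lL; have sL := lattice_subgroup lL; case: lL => [[L0 LD LZ] finL].
pose phi w : 'rV[B]_(1 + d) := row_mx 0 w.
have phiB : {morph phi : u v / u - v}.
  by move=> u v; rewrite /phi opp_row_mx add_row_mx oppr0 addr0.
pose phiH := GRing.isZmodMorphism.Build _ _ phi phiB.
pose phia : {additive _ -> _} := HB.pack phi phiH.
split; last first.
  by apply: (finite_index_preimage (phi := phia) sL _ _ finL) => //;
    exact: (subgroup_preimage phia sL).
split=> [|u v|a v]; rewrite /tail /=.
- by rewrite row_mx0.
- by move=> Lu /(LD _ _ Lu); rewrite add_row_mx addr0.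
- by move=> /(LZ a); rewrite scale_row_mx scaler0.
Qed.

Lemma leading_ideal L : lattices (1 + d) L -> exists j, leading L = pideal (p j).
Proof.
move=> lL; have sL := lattice_subgroup lL; case: lL => [[L0 LD LZ] finL].
have sI : subgroup (leading L).
  split=> [|_ _ [u Lu <-] [v Lv <-]|_ [u Lu <-]].
  - by exists 0; rewrite ?mxE.
  - by exists (u + v); rewrite ?mxE //; apply: LD.
  - by exists (- u); rewrite ?mxE //; case: sL => _ _; apply.
apply: (ps_ideal ps sI) => [a _ [v Lv <-]|].
  by exists (a *: v); rewrite ?mxE //; apply: (LZ a).
have [r [_ rE _]] := subm_indexP sL finL.
apply: (cover_finite_index (c := fun i => r i 0 0)) => // c _.
have [i Li] := rE (row_mx c%:M 0) I.
exists i, (row_mx c%:M 0 - r i); first exact: Li.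
by rewrite mxE [X in _ + X]mxE row_mx_head.
Qed.

Lemma glueP L : lattices (1 + d) L -> exists j w,
  leading L = pideal (p j) /\ L = glue j (tail L) w.
Proof.
move=> lL; have [j Lj] := leading_ideal lL.
have sL := lattice_subgroup lL; case: lL => [[L0 LD LZ] finL].
have [v0 Lv0 v0E] : leading L (p j) by rewrite Lj; exists 1; rewrite ?mul1r.
exists j, (rsubmx v0); split=> //.
have key v c : v 0 0 = c * p j ->
    row_mx 0 (rsubmx v - c *: rsubmx v0) = v - c *: v0.
  move=> vc; rewrite [RHS]head_row_mx !mxE v0E vc subrr; congr row_mx.
    by rewrite raddf0.
  by apply/rowP => i; rewrite !mxE.
apply/seteqP; split=> [v Lv|v [c [vc]]].
  have [c _ cE] : pideal (p j) (v 0 0) by rewrite -Lj; exists v.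
  exists c; split=> //; rewrite /tail /= key //.
  by apply: subgroupB => //; apply: (LZ c).
rewrite /tail /= key // => Lvc.
by apply: subgroup_subr Lvc => //; apply: (LZ c).
Qed.

Lemma glue_subgroup j (L' : set 'rV[B]_d) w :
  is_submodule (idfun : B -> B) L' -> is_submodule (idfun : B -> B) (glue j L' w).
Proof.
move=> [L0 LD LZ]; split.
- by exists 0; rewrite mxE mul0r scale0r subr0 linear0.
- move=> u v [c [uc Lu]] [e [ve Lv]]; exists (c + e).
  rewrite mxE uc ve mulrDl; split=> //.
  by rewrite linearD scalerDl opprD addrACA; apply: LD.
- move=> a v [c [vc Lv]]; exists (a * c); rewrite mxE vc mulrA; split=> //.
  have -> : rsubmx (a *: v) = a *: rsubmx v by apply/rowP => i; rewrite !mxE.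
  by rewrite -scalerA -scalerBr; apply: (LZ a).
Qed.

Lemma glue_lattice j L' w : lattices d L' ->
  lattices (1 + d) (glue j L' w) /\
  subm_index (glue j L' w) = (n j * subm_index L')%N.
Proof.
move=> lL'; have sL' := lattice_subgroup lL'; case: lL' => [mL' finL'].
have mL := glue_subgroup j w mL'.
have sL := @submodule_subgroup B B idfun _ _ mL.
have [r rT] := ps_index ps j; have [t [_ tE tU]] := subm_indexP sL' finL'.
pose M : set 'rV[B]_(1 + d) := [set v : 'rV_(1 + d) | pideal (p j) (v 0 0)].
have sM : subgroup M.
  have [I0 ID IN] := pideal_subgroup (p j).
  by split=> [|u v|u]; rewrite /M /= !mxE //; [apply: ID|apply: IN].
have LM : glue j L' w `<=` M by move=> v [c [vc _]]; rewrite /M /= vc; exists c.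
have sT : coset_reps setT M (fun i => row_mx (r i)%:M 0).
  have [_ rE rU] := rT; split=> // [v _|i i'].
    have [i Ii] := rE (v 0 0) I; exists i.
    by rewrite /M /= mxE [X in _ + X]mxE row_mx_head.
  by rewrite /M /= mxE [X in _ + X]mxE !row_mx_head => /rU.
have rsub (x : 'rV[B]_d) (y : 'M[B]_1) : rsubmx (row_mx y x) = x by rewrite row_mxKr.
have tT : coset_reps M (glue j L' w) (fun b => row_mx 0 (t b)).
  split=> [b|v [c _ vc]|b b'].
  - by rewrite /M /= row_mx0_head; exists 0; rewrite ?mul0r.
  - have [b Lb] := tE (rsubmx v - c *: w) I; exists b, c.
    rewrite mxE [X in _ + X]mxE row_mx0_head subr0; split=> //.
    by rewrite linearB /= rsub addrAC.
  - move=> [c []]; rewrite mxE [X in _ + X]mxE !row_mx0_head subr0 => /esym.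
    move=> /(ps_regular ps) ->; rewrite scale0r subr0 linearB /= !rsub.
    exact: tU.
have gT := coset_reps_chain (@subgroupT _) sM sL LM (fun _ _ => I) sT tT.
split; last by rewrite (subm_index_coset_reps sL gT) card_prod !card_ord.
by split=> //; apply: coset_reps_finite_index gT.
Qed.

Lemma leading_glue j L' w : is_submodule (idfun : B -> B) L' ->
  leading (glue j L' w) = pideal (p j).
Proof.
move=> [L0 _ _]; apply/seteqP; split=> [_ [v [c [-> _]] <-]|_ [c _ <-]].
  by exists c.
exists (row_mx (c * p j)%:M (c *: w)); last by rewrite row_mx_head.
by exists c; rewrite row_mx_head row_mxKr subrr.
Qed.

(** The generator p j is regular, so a multiple of the vector (p j, w) with first
    coordinate 0 is 0. *)
Lemma tail_glue j L' w : tail (glue j L' w) = L'.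
Proof.
apply/seteqP; split=> [v [c []]|v Lv].
  rewrite row_mx0_head => /esym/(ps_regular ps) ->.
  by rewrite scale0r subr0 row_mxKr.
by exists 0; rewrite row_mx0_head mul0r scale0r subr0 row_mxKr.
Qed.

Lemma glue_eqP j L' w w' : is_submodule (idfun : B -> B) L' ->
  glue j L' w = glue j L' w' <-> L' (w - w').
Proof.
move=> mL'; have sL' := @submodule_subgroup B B idfun _ _ mL'.
split=> [/seteqP[+ _]|Lw].
  move=> /(_ (row_mx (p j)%:M w)) [|c].
    by exists 1; rewrite row_mx_head mul1r scale1r row_mxKr subrr; case: mL'.
  rewrite row_mx_head row_mxKr => -[pE]; suff -> : c = 1 by rewrite scale1r.
  by apply/eqP; rewrite -subr_eq0; apply/eqP/(ps_regular ps (j := j));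
    rewrite mulrBl -pE mul1r subrr.
apply/seteqP; split=> v [c [vc Lv]]; exists c; split=> //.
  have [_ LD LZ] := mL'; have := LD _ _ Lv (LZ c _ Lw).
  by rewrite scalerBr addrA subrK.
have [_ LD LZ] := mL'; have := LD _ _ Lv (LZ c _ (subgroup_sym sL' Lw)).
by rewrite scalerBr addrA subrK.
Qed.

End Glue.

(** Lattices are free: induct on the rank, gluing a generator of the leading
    ideal onto a basis of the tail. *)
Lemma lattice_free d (L : set 'rV[B]_d) : lattices d L ->
  exists g : 'M[B]_d, (forall v : 'rV[B]_d, v *m g = 0 -> v = 0) /\
    L = [set v *m g | v in setT].
Proof.
elim: d L => [|d IHd] L lL.
  exists 0; split=> [v _|]; first by rewrite [v]thinmx0.
  case: lL => [[L0 _ _] _]; apply/seteqP; split=> [v _|v _].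
    by exists v; rewrite // [v]thinmx0 mul0mx.
  by rewrite [v]thinmx0.
suff: exists g : 'M[B]_(1 + d), (forall v : 'rV_(1 + d), v *m g = 0 -> v = 0) /\
    L = [set v *m g | v in [set: 'rV_(1 + d)]] by [].
have [j [w [_ LE]]] := glueP lL.
have [g [gI gE]] := IHd _ (tail_lattice lL).
pose G : 'M[B]_(1 + d) := block_mx (p j)%:M w 0 g.
have mulG (v : 'rV[B]_(1 + d)) :
    v *m G = row_mx (v 0 0 * p j)%:M (v 0 0 *: w + rsubmx v *m g).
  rewrite {1}[v]head_row_mx mul_row_block mulmx0 addr0 -scalar_mxM.
  by rewrite mul_scalar_mx.
exists G; split=> [v vG|].
  have v0 : v 0 0 = 0.
    apply: (ps_regular ps (j := j)).
    by rewrite -(row_mx_head (v 0 0 * p j) (v 0 0 *: w + rsubmx v *m g)) -mulG vG mxE.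
  have : rsubmx (v *m G) = 0 by rewrite vG linear0.
  rewrite mulG row_mxKr v0 scale0r add0r => /gI vr.
  by rewrite [v]head_row_mx v0 vr raddf0 row_mx0.
apply/seteqP; split=> [v|_ [v _ <-]]; rewrite LE.
  move=> [c [vc]]; rewrite gE => -[x _ xE].
  exists (row_mx c%:M x) => //; rewrite mulG row_mx_head row_mxKr xE -vc.
  by rewrite addrC subrK -head_row_mx.
exists (v 0 0); rewrite mulG row_mx_head row_mxKr addrC addKr; split=> //.
by rewrite gE; exists (rsubmx v).
Qed.

(** A lattice of rank d + 1 is a leading ideal p j B, a tail L', and the class
    modulo L' of the vector lying over p j. *)
Lemma esum_latticesS (R : realType) d (f : nat -> \bar R) :
  (forall i, 0 <= f i)%E ->
  (\esum_(L in lattices d.+1) f (subm_index L) =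
   \esum_(j in [set: J]) \esum_(L in lattices d)
      ((subm_index L)%:R%:E * f (n j * subm_index L)%N))%E.
Proof.
move=> f0.
pose E := [set pideal (p j) | j in [set: J]] `*` lattices d.
rewrite (esum_fibre (p := fun L : set 'rV[B]_(1 + d) => (leading L, tail L))
                    (E := E)) //; last first.
  move=> L lL; split; last exact: tail_lattice.
  by have [j ->] := leading_ideal lL; exists j.
rewrite [RHS]esum_esum; last by move=> *; rewrite mule_ge0 // lee_fin.
pose h (x : J * set 'rV[B]_d) := (pideal (p x.1), x.2).
rewrite (reindex_esum ([set: J] `*` lattices d) _ h); last first.
  split=> [[j L] /= [_ lL]|[i L] [j L'] _ _ [/(ps_inj ps) -> ->] //|[I L]].
    by split=> //; exists j.
  by move=> [[j _ /= <-] lL]; exists (j, L).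
apply: eq_esum => -[j L] [_ /= lL].
have [mL finL] := lL; have sL := lattice_subgroup lL.
have [t [_ tE tU]] := subm_indexP sL finL.
rewrite (@esum_cst_bij _ _ _ _ (fun b => glue j L (t b)) _
   (f (n j * subm_index L)%N)) ?card_ord //.
  split.
  - move=> b _; split; first by have [] := glue_lattice j (t b) lL.
    by rewrite /h /= leading_glue // tail_glue.
  - by move=> b b' _ _ /(glue_eqP _ _ _ mL)/tU.
  - move=> L0 [lL0 [lead0 tail0]]; have [i [w [lead1 L0E]]] := glueP lL0.
    have [b Lb] := tE w I; exists b => //.
    have -> : j = i by apply: (ps_inj ps); rewrite -lead0 -lead1.
    rewrite L0E tail0; apply/glue_eqP => //.
    by apply: subgroup_sym.
move=> L0 [lL0 [lead0 tail0]]; have [i [w [lead1 L0E]]] := glueP lL0.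
have ij : j = i by apply: (ps_inj ps); rewrite -lead0 -lead1.
by rewrite L0E tail0 -ij; have [_ ->] := glue_lattice j w lL.
Qed.

End PrincipalIdeals.

(** * Power series *)

Section PowerSeriesRing.
Variable A : comNzRingType.
Implicit Types (f g : {fps A}) (a i : nat).

Local Notation "'X" := (fpsX : {fps A}) : ring_scope.

Lemma fcoefD f g i : fcoef (f + g) i = fcoef f i + fcoef g i. Proof. by []. Qed.
Lemma fcoefN f i : fcoef (- f) i = - fcoef f i. Proof. by []. Qed.
Lemma fcoefM f g i :
  fcoef (f * g) i = \sum_(j < i.+1) fcoef f j * fcoef g (i - j)%N.
Proof. by []. Qed.

Lemma fcoefXM f i : fcoef ('X * f) i = if i is j.+1 then fcoef f j else 0.
Proof.
rewrite fcoefM big_ord_recl /= mul0r add0r; case: i => [|i].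
  by rewrite big_ord0.
rewrite big_ord_recl /= mul1r subSS subn0 big1 ?addr0 // => j _.
by rewrite mul0r.
Qed.

Lemma fcoefXnM a f i :
  fcoef ('X ^+ a * f) i = if (i < a)%N then 0 else fcoef f (i - a).
Proof.
elim: a i => [|a IHa] i; first by rewrite expr0 mul1r subn0.
by rewrite exprS -mulrA fcoefXM; case: i => [|i] //; rewrite IHa.
Qed.

Lemma fcoefCM (c : A) f i : fcoef (fpsC c * f) i = c * fcoef f i.
Proof.
rewrite fcoefM big_ord_recl /= subn0 big1 ?addr0 // => j _.
by rewrite mul0r.
Qed.

Fact fpsC_zmod : {morph @fpsC A : c c' / c - c'}.
Proof. by move=> c c'; apply: fpsP => -[|i] //=; rewrite subrr. Qed.
Fact fpsC_monoid : monoid_morphism (@fpsC A).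
Proof.
split=> // c c'; apply: fpsP => i; rewrite fcoefCM /=.
by case: (i == 0%N); rewrite ?mulr0.
Qed.
HB.instance Definition _ := GRing.isZmodMorphism.Build _ _ (@fpsC A) fpsC_zmod.
HB.instance Definition _ := GRing.isMonoidMorphism.Build _ _ (@fpsC A) fpsC_monoid.

End PowerSeriesRing.

Section PowerSeriesField.
Variable k : fieldType.
Implicit Types (f g h u : {fps k}) (a : nat).

Local Notation "'X" := (fpsX : {fps k}) : ring_scope.

Lemma fpsXn_regular a f : f * 'X ^+ a = 0 -> f = 0.
Proof.
rewrite mulrC => fX; apply: fpsP => i.
have : fcoef ('X ^+ a * f) (i + a) = 0 by rewrite fX.
by rewrite fcoefXnM ltnNge leq_addl /= addnK.
Qed.

(** Reduction modulo X. *)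
Definition fps0 f : k := fcoef f 0.
Arguments fps0 : simpl never.

Fact fps0_zmod : {morph fps0 : f g / f - g}. Proof. by []. Qed.
Fact fps0_monoid : monoid_morphism fps0.
Proof. by split=> [|f g] //; rewrite /fps0 fcoefM big_ord1. Qed.
HB.instance Definition _ := GRing.isZmodMorphism.Build _ _ fps0 fps0_zmod.
HB.instance Definition _ := GRing.isMonoidMorphism.Build _ _ fps0 fps0_monoid.

Definition fps_shift a f : {fps k} := Fps (fun i => fcoef f (i + a)).

Lemma fps_shiftE a f : (forall i, (i < a)%N -> fcoef f i = 0) ->
  f = 'X ^+ a * fps_shift a f.
Proof.
move=> f0; apply: fpsP => i; rewrite fcoefXnM.
by case: ltnP => [/f0 //|ai] /=; rewrite subnK.
Qed.

Lemma fps0_eq0 f : fps0 f = 0 -> f = 'X * fps_shift 1 f.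
Proof. by move=> f0; rewrite -[X in X * _]expr1; apply: fps_shiftE => -[]. Qed.

(** The geometric series; its coefficient of index i only involves the powers
    up to i. *)
Lemma fps_geometric h : fps0 h = 0 -> exists g, g * (1 - h) = 1.
Proof.
move=> h0; pose g : {fps k} := Fps (fun i => fcoef (\sum_(j < i.+1) h ^+ j) i).
have hX j i : (i < j)%N -> fcoef (h ^+ j) i = 0.
  by move=> ij; rewrite (fps0_eq0 h0) exprMn fcoefXnM ij.
have gE n i : (i <= n)%N -> fcoef g i = fcoef (\sum_(j < n.+1) h ^+ j) i.
  have fsum N (F : nat -> {fps k}) l :
      fcoef (\sum_(j < N) F j) l = \sum_(j < N) fcoef (F j) l.
    elim: N => [|N IHN]; first by rewrite !big_ord0.
    by rewrite !big_ord_recr /= IHN.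
  move=> leqin; rewrite /g /= !fsum.
  rewrite (big_ord_widen n.+1 (fun j => fcoef (h ^+ j) i)) //.
  rewrite [RHS](bigID (fun j : 'I_n.+1 => (j < i.+1)%N)) /=.
  by rewrite [X in _ + X]big1 ?addr0 // => j; rewrite -leqNgt => /hX.
exists g; apply: fpsP => n.
transitivity (fcoef ((\sum_(j < n.+1) h ^+ j) * (1 - h)) n).
  rewrite mulrC [in RHS]mulrC !fcoefM; apply: eq_bigr => i _.
  by rewrite -gE // leq_subr.
have -> : (\sum_(j < n.+1) h ^+ j) * (1 - h) = 1 - h ^+ n.+1.
  by apply: oppr_inj; rewrite -mulrN !opprB subrX1 mulrC.
by rewrite fcoefD fcoefN hX // subr0.
Qed.

Lemma fps_inv f : fps0 f != 0 -> exists g, g * f = 1.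
Proof.
move=> f0; have [|g gE] := @fps_geometric (1 - fpsC (fps0 f)^-1 * f).
  by rewrite rmorphB rmorph1 rmorphM /= [X in X * _]/fps0 /= mulVf // subrr.
by exists (g * fpsC (fps0 f)^-1); rewrite -mulrA -gE opprB addrC subrK.
Qed.

Lemma fps_valuation f : f != 0 -> exists a u, f = 'X ^+ a * u /\ fps0 u != 0.
Proof.
move=> f0; have exi : exists i, fcoef f i != 0.
  apply: contrapT => /forallNP nf; move/eqP: f0; apply; apply: fpsP => i.
  by apply/eqP; apply: contrapT => /negP; apply: nf.
case: (ex_minnP exi) => a fa mina; exists a, (fps_shift a f); split=> //.
apply: fps_shiftE => i ia; apply/eqP; apply: contraTT ia => /mina.
by rewrite leqNgt.
Qed.

Lemma fps_factor f : f != 0 ->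
  exists a u v, f = 'X ^+ a * u /\ v * u = 1.
Proof.
by move=> /fps_valuation[a [u [-> /fps_inv[v vu]]]]; exists a, u, v.
Qed.

Lemma fpsXn_neq0 a : 'X ^+ a != 0.
Proof.
apply/eqP => Xa; have := @fpsXn_regular a 1; rewrite mul1r => /(_ Xa)/eqP.
by rewrite oner_eq0.
Qed.

End PowerSeriesField.

Lemma coset_reps_card_ord (V : zmodType) (L N : set V) (J : finType)
    (r : J -> V) n :
  #|J| = n -> coset_reps L N r -> exists s : 'I_n -> V, coset_reps L N s.
Proof.
move=> <- [Lr rE rU]; exists (fun i => r (enum_val i)); split=> //.
  by move=> v /rE[j Nj]; exists (enum_rank j); rewrite enum_rankK.
by move=> i j /rU/enum_val_inj.
Qed.

Section PowerSeriesIdeals.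
Variable k : finFieldType.
Local Notation S := {fps k}.
Local Notation "'X" := (fpsX : S) : ring_scope.

Definition fps_of_ffun a (c : {ffun 'I_a -> k}) : S :=
  Fps (fun i => oapp c 0 (insub i)).

Lemma fpsXn_coset_reps a :
  coset_reps setT (pideal ('X ^+ a)) (@fps_of_ffun a).
Proof.
have cE (c : {ffun 'I_a -> k}) (i : 'I_a) : fcoef (fps_of_ffun c) i = c i.
  by rewrite /= valK.
split=> // [f _|c c' [f _ fE]].
  exists [ffun i : 'I_a => fcoef f i].
  exists (fps_shift a (f - fps_of_ffun [ffun i : 'I_a => fcoef f i])) => //.
  rewrite mulrC -fps_shiftE // => i ia.
  by rewrite fcoefD fcoefN (cE _ (Ordinal ia)) ffunE subrr.
apply/ffunP => i; apply/eqP; rewrite -subr_eq0 -!cE -fcoefN -fcoefD -fE.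
by rewrite mulrC fcoefXnM ltn_ord.
Qed.

(** By finiteness two powers of X agree modulo the ideal, and X^i - X^j is X^i
    times a unit. *)
Lemma finite_index_ideal_Xn (I : set S) :
  subgroup I -> (forall a b, I b -> I (a * b)) -> finite_index setT I ->
  exists a, I ('X ^+ a).
Proof.
move=> sI IM /(finite_index_coset_reps sI)[r [_ rE _]].
have [c cE] := choice (fun i : nat => rE ('X ^+ i) Logic.I).
set n := #|` _|%fset in r rE c cE.
have /injectivePn[i [j ij cij]] : ~~ injectiveb (fun i : 'I_n.+1 => c i).
  by apply/negP => /injectiveP/leq_card; rewrite !card_ord ltnn.
wlog lij : i j ij cij / (i < j)%N.
  move=> IH; have [|ji|/val_inj/eqP] := ltngtP i j; first exact: IH.
    by apply: (IH j i) => //; rewrite eq_sym.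
  by rewrite (negPf ij).
exists i; have Iij : I ('X ^+ i - 'X ^+ j).
  by apply: (subgroup_trans sI (cE i)); rewrite cij; apply: subgroup_sym.
have [|g gE] := @fps_geometric k ('X ^+ (j - i)).
  by rewrite rmorphXn /= expr0n subn_eq0 leqNgt lij.
have := IM g _ Iij; have -> : 'X ^+ i - 'X ^+ j = (1 - 'X ^+ (j - i)) * 'X ^+ i.
  by rewrite mulrBl mul1r -exprD subnK // ltnW.
by rewrite mulrA gE mul1r.
Qed.

Lemma fps_principal_system :
  principal_system (fun a => 'X ^+ a) (fun a => #|k| ^ a)%N.
Proof.
split.
- by move=> a f; apply: fpsXn_regular.
- move=> a; apply: coset_reps_card_ord (fpsXn_coset_reps a).
  by rewrite card_ffun card_ord.
- move=> I sI IM finI.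
  have exI : exists a, `[< I ('X ^+ a) >].
    by have [a Ia] := finite_index_ideal_Xn sI IM finI; exists a; apply/asboolP.
  case: (ex_minnP exI) => a /asboolP Ia mina; exists a.
  apply/seteqP; split=> [f If|_ [f _ <-]]; last exact: IM.
  have [->|f0] := eqVneq f 0; first by exists 0; rewrite ?mul0r.
  have [b [u [v [fE vu]]]] := fps_factor f0.
  have ab : (a <= b)%N.
    by apply: mina; apply/asboolP; have := IM v _ If; rewrite fE mulrCA vu mulr1.
  by exists ('X ^+ (b - a) * u) => //; rewrite fE mulrAC -exprD subnK.
- have main a b : pideal ('X ^+ a : S) = pideal ('X ^+ b) -> (b <= a)%N.
    move=> /seteqP[/(_ ('X ^+ a)) + _]; rewrite leqNgt => -[|f _ fE].
      by exists 1; rewrite ?mul1r.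
    apply/negP => ab; move/(congr1 (fun h => fcoef h a)): fE.
    rewrite mulrC fcoefXnM ab -[X in fcoef X a]mulr1 fcoefXnM ltnn subnn.
    by move/eqP; rewrite eq_sym oner_eq0.
  by move=> a b ab; apply/eqP; rewrite eqn_leq !main.
Qed.

End PowerSeriesIdeals.

(** * The product of two power series rings *)

(** B is the product of two copies of k[[X]], through the idempotents 1 - e
    and e; sigma is the diagonal embedding. *)
Record split_ring (k : fieldType) (B : comNzRingType)
    (sigma : {rmorphism {fps k} -> B}) (e : B) : Prop := SplitRing {
  split_idem : e * e = e;
  split_inj : forall f g, sigma f * (1 - e) + sigma g * e = 0 -> f = 0 /\ g = 0;
  split_gen : forall b, exists f g, b = sigma f * (1 - e) + sigma g * e }.

Section SplitRing.
Variables (k : finFieldType) (B : comNzRingType).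
Variables (sigma : {rmorphism {fps k} -> B}) (e : B).
Hypothesis sp : split_ring sigma e.
Local Notation "'X" := (fpsX : {fps k}) : ring_scope.

Definition spair f g : B := sigma f * (1 - e) + sigma g * e.

Lemma spairD f g f' g' : spair f g + spair f' g' = spair (f + f') (g + g').
Proof. by rewrite /spair !rmorphD /=; ring. Qed.

Lemma spairN f g : - spair f g = spair (- f) (- g).
Proof. by rewrite /spair !rmorphN /=; ring. Qed.

Lemma spairB f g f' g' : spair f g - spair f' g' = spair (f - f') (g - g').
Proof. by rewrite spairN spairD. Qed.

Lemma spairM f g f' g' : spair f g * spair f' g' = spair (f * f') (g * g').
Proof.
rewrite /spair !rmorphM /=.
have -> : (sigma f * (1 - e) + sigma g * e) * (sigma f' * (1 - e) + sigma g' * e)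
  = sigma f * sigma f' * (1 - e - e + e * e)
    + (sigma f * sigma g' + sigma g * sigma f') * (e - e * e)
    + sigma g * sigma g' * (e * e) by ring.
by rewrite (split_idem sp); ring.
Qed.

Lemma spair_diag f : spair f f = sigma f.
Proof. by rewrite /spair; ring. Qed.

Lemma spair00 : spair 0 0 = 0.
Proof. by rewrite /spair rmorph0; ring. Qed.

Lemma spair_inj f g f' g' : spair f g = spair f' g' -> f = f' /\ g = g'.
Proof.
move=> /eqP; rewrite -subr_eq0 spairB => /eqP/(split_inj sp)[].
by move=> /eqP; rewrite subr_eq0 => /eqP -> /eqP; rewrite subr_eq0 => /eqP ->.
Qed.

Lemma spairP b : exists f g, b = spair f g. Proof. exact: (split_gen sp). Qed.

Lemma spair_pideal a b f g :
  pideal (spair ('X ^+ a) ('X ^+ b)) (spair f g) <->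
  pideal ('X ^+ a) f /\ pideal ('X ^+ b) g.
Proof.
split=> [[c _]|[[f' _ <-] [g' _ <-]]]; last first.
  by exists (spair f' g'); rewrite ?spairM.
have [f' [g' ->]] := spairP c; rewrite spairM => /spair_inj[<- <-].
by split; [exists f'|exists g'].
Qed.

(** An ideal contains the components of its elements along 1 - e and e, so it
    is the product of two ideals of k[[X]]. *)
Lemma split_principal_system :
  principal_system (fun ab : nat * nat => spair ('X ^+ ab.1) ('X ^+ ab.2))
                   (fun ab => #|k| ^ (ab.1 + ab.2))%N.
Proof.
have psk := fps_principal_system k; split.
- move=> [a b] c /=; have [f [g ->]] := spairP c; rewrite spairM.
  by move=> /(split_inj sp)[/fpsXn_regular -> /fpsXn_regular ->];
    rewrite /spair rmorph0; ring.
- move=> [a b] /=; have [r [_ rE rU]] := ps_index psk a.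
  have [s [_ sE sU]] := ps_index psk b.
  apply: (@coset_reps_card_ord _ _ _ ('I_(#|k| ^ a) * 'I_(#|k| ^ b))%type
            (fun ij => spair (r ij.1) (s ij.2))).
    by rewrite card_prod !card_ord expnD.
  split=> // [c _|[i j] [i' j']] /=.
    have [f [g ->]] := spairP c; have [i fi] := rE f Logic.I.
    have [j gj] := sE g Logic.I; exists (i, j); rewrite spairB.
    by apply/spair_pideal.
  by rewrite spairB => /spair_pideal[/rU -> /sU ->].
- move=> I sI IM finI.
  have comp (u : {fps k} -> B) : {morph u : f g / f - g} ->
      (forall f g, u (f * g) = sigma f * u g) ->
      exists a, u @^-1` I = pideal ('X ^+ a).
    move=> uB uM; pose uH := GRing.isZmodMorphism.Build _ _ u uB.
    pose ua : {additive _ -> _} := HB.pack u uH.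
    have sJ : subgroup (u @^-1` I) by apply: (subgroup_preimage ua sI).
    apply: (ps_ideal psk sJ) => [f g Ig|]; first by rewrite /= uM; apply: IM.
    exact: (finite_index_preimage (phi := ua) sI sJ).
  have [a aE] : exists a, (fun f => spair f 0) @^-1` I = pideal ('X ^+ a).
    apply: comp => [f g|f g]; first by rewrite spairB subr0.
    by rewrite -spair_diag spairM mulr0.
  have [b bE] : exists a, (fun f => spair 0 f) @^-1` I = pideal ('X ^+ a).
    apply: comp => [f g|f g]; first by rewrite spairB subr0.
    by rewrite -spair_diag spairM mulr0.
  exists (a, b) => /=; apply/seteqP; split=> c; have [f [g ->]] := spairP c.
    move=> Ic; apply/spair_pideal; rewrite -aE -bE; split.
      by have := IM (spair 1 0) _ Ic; rewrite spairM mul1r mul0r.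
    by have := IM (spair 0 1) _ Ic; rewrite spairM mul1r mul0r.
  move=> /spair_pideal; rewrite -aE -bE => -[If Ig].
  by case: sI => _ ID _; have := ID _ _ If Ig; rewrite spairD addr0 add0r.
- move=> [a b] [a' b'] /= E.
  have key f g : pideal ('X ^+ a) f /\ pideal ('X ^+ b) g <->
                 pideal ('X ^+ a') f /\ pideal ('X ^+ b') g.
    by rewrite -!spair_pideal E.
  have P0 c : pideal ('X ^+ c : {fps k}) 0 by exists 0; rewrite ?mul0r.
  congr (_, _); apply: (ps_inj psk); apply/seteqP; split=> f fP.
  + by have [/(_ (conj fP (P0 _)))[]] := key f 0.
  + by have [_ /(_ (conj fP (P0 _)))[]] := key f 0.
  + by have [/(_ (conj (P0 _) fP))[]] := key 0 f.
  + by have [_ /(_ (conj (P0 _) fP))[]] := key 0 f.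
Qed.

End SplitRing.

(** * Counting matrices and subspaces over a finite field *)

Section FiniteFieldCounts.
Local Close Scope classical_set_scope.
Variable k : finFieldType.
Local Notation q := #|k|.

Lemma card_submx d l (M : 'M[k]_(l, d)) :
  #|[set v : 'rV[k]_d | (v <= M)%MS]| = (q ^ \rank M)%N.
Proof.
have -> : [set v : 'rV[k]_d | (v <= M)%MS] =
          [set u *m row_base M | u in [set: 'rV[k]_(\rank M)]].
  apply/setP => v; rewrite inE -(eq_row_base M); apply/submxP/imsetP.
    by move=> [u ->]; exists u.
  by move=> [u _ ->]; exists u.
rewrite card_imset ?cardsT ?card_mx ?mul1n //.
exact/row_free_inj/row_base_free.
Qed.

(** The n-tuples of vectors that are independent modulo the row space of K. *)
Definition frames d l (K : 'M[k]_(l, d)) n : {set 'M[k]_(n, d)} :=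
  [set A | \rank (A + K)%MS == (n + \rank K)%N].

Lemma rank_add_row d l (M : 'M[k]_(l, d)) (a : 'rV[k]_d) :
  \rank (a + M)%MS = (~~ (a <= M)%MS + \rank M)%N.
Proof.
have [aM|aM] := boolP (a <= M)%MS; first by rewrite (addsmx_idPr aM).
have := mxrank_sum_cap a M.
have -> : \rank a = 1%N.
  by rewrite rank_rV (contraNneq _ aM) // => ->; rewrite sub0mx.
suff -> : \rank (a :&: M)%MS = 0%N by rewrite addn0.
apply/eqP; rewrite mxrank_eq0 -submx0; apply: contraNT aM => aM0.
have a1 : (\rank a <= \rank (a :&: M)%MS)%N.
  by apply: (leq_trans (rank_leq_row a)); rewrite lt0n mxrank_eq0 -submx0.
have [_] := mxrank_leqif_sup (capmxSl a M).
rewrite eqn_leq mxrankS ?capmxSl //= a1 => /esym aM'.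
exact: submx_trans aM' (capmxSr a M).
Qed.

(** A frame is extended by any vector outside the space spanned by the frame
    and by K, which has q^(n + rank K) elements. *)
Lemma mem_framesS d l (K : 'M[k]_(l, d)) n (a : 'rV[k]_d) (A : 'M[k]_(n, d)) :
  ((col_mx a A : 'M[k]_(n.+1, d)) \in frames K n.+1) =
  (A \in frames K n) && ~~ (a <= A + K)%MS.
Proof.
rewrite !inE.
have -> : \rank ((col_mx a A : 'M[k]_(n.+1, d)) + K)%MS = \rank (a + (A + K))%MS.
  by apply: eqmx_rank; apply/eqmxP; rewrite addsmxA;
    apply: adds_eqmx => //; apply: eqmx_sym; apply: addsmxE.
rewrite rank_add_row addSn.
have le1 : (\rank (A + K)%MS <= n + \rank K)%N.
  apply: leq_trans (leq_add (rank_leq_row A) (leqnn _)).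
  by rewrite -mxrank_sum_cap leq_addr.
by case: (a <= _)%MS; rewrite /= ?add0n ?andbF ?add1n ?eqSS ?andbT //;
  apply/eqP => E; rewrite E ltnn in le1.
Qed.

Lemma card_frames d l (K : 'M[k]_(l, d)) n :
  #|frames K n| = (\prod_(j < n) (q ^ d - q ^ (\rank K + j)))%N.
Proof.
elim: n => [|n IHn].
  rewrite big_ord0 (_ : frames K 0 = [set: _]) ?cardsT ?card_mx ?mul0n //.
  apply/setP => A; rewrite !inE add0n [A]flatmx0.
  by rewrite adds0mx eqxx.
pose h (p : 'M[k]_(n, d) * 'rV[k]_d) : 'M[k]_(n.+1, d) := col_mx p.2 p.1.
have hI : injective h.
  move=> [A a] [B b]; rewrite /h /= => AB.
  by have [-> ->] := @eq_col_mx _ 1 n d a A b B AB.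
pose D := [set p : 'M[k]_(n, d) * 'rV[k]_d |
            (p.1 \in frames K n) && ~~ (p.2 <= p.1 + K)%MS].
have -> : frames K n.+1 = h @: D.
  apply/setP => A; apply/idP/imsetP => [fA|[[B b] + ->]].
    exists (dsubmx (A : 'M[k]_(1 + n, d)), usubmx (A : 'M[k]_(1 + n, d))).
      by rewrite inE /= -mem_framesS vsubmxK.
    by rewrite /h /= vsubmxK.
  by rewrite inE mem_framesS.
rewrite card_imset // -sum1_card big_mkcond /=.
pose F A a := (if (A, a) \in D then 1 else 0)%N.
rewrite (eq_bigr (fun p => F p.1 p.2)); last by case.
rewrite -(pair_bigA _ F) /F /=.
rewrite big_ord_recr /= -IHn -sum1_card big_distrl /= [RHS]big_mkcond /=.
apply: eq_bigr => A _; rewrite -big_mkcond /=.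
have [fA|fA] := boolP (A \in frames K n); last first.
  by rewrite big_pred0 // => a; rewrite inE /= (negPf fA).
rewrite mul1n (eq_bigl (fun a => a \in ~: [set v | (v <= A + K)%MS])).
  rewrite sum1_card cardsCs finset.setCK card_submx card_mx mul1n.
  by move: fA; rewrite inE => /eqP ->; rewrite addnC.
by move=> a; rewrite /D inE /= fA finset.in_setC inE.
Qed.

Lemma mem_frames0 d n (A : 'M[k]_(n, d)) :
  (A \in frames (0 : 'M[k]_d) n) = row_free A.
Proof. by rewrite inE addsmx0 mxrank0 addn0. Qed.

Lemma card_row_full d r :
  #|[set G : 'M[k]_(d, r) | row_full G]| = (\prod_(j < r) (q ^ d - q ^ j))%N.
Proof.
have := card_frames (0 : 'M[k]_d) r; rewrite mxrank0 => <-.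
rewrite -(card_imset (mem (frames (0 : 'M[k]_d) r)) (@trmx_inj _ _ _)).
apply: eq_card => G; rewrite inE; apply/idP/imsetP => [fG|[A + ->]].
  by exists G^T; rewrite ?trmxK // mem_frames0 /row_free mxrank_tr.
by rewrite mem_frames0 /row_full mxrank_tr.
Qed.

(** Subspaces, represented by canonical matrices. *)
Definition subspaces_avoiding d l (K : 'M[k]_(l, d)) n : {set 'M[k]_d} :=
  [set U | [&& <<U>>%MS == U, \rank U == n & (U :&: K)%MS == 0]].

(** Each subspace of dimension n has as many bases as there are invertible
    matrices of order n. *)
Lemma card_subspaces_avoiding d l (K : 'M[k]_(l, d)) n :
  (#|subspaces_avoiding K n| * \prod_(j < n) (q ^ n - q ^ j) =
   \prod_(j < n) (q ^ d - q ^ (\rank K + j)))%N.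
Proof.
rewrite -card_row_full -card_frames -sum1_card big_distrl /=.
rewrite -[RHS]sum1_card.
have inU (A : 'M[k]_(n, d)) : (A \in frames K n) =
    row_free A && ((A :&: K)%MS == 0).
  rewrite inE -mxrank_eq0; have := mxrank_sum_cap A K.
  have := rank_leq_row A; rewrite /row_free.
  by move: (\rank A) (\rank (A :&: K)%MS) (\rank (A + K)%MS) => a b c; lia.
rewrite (partition_big (fun A : 'M[k]_(n, d) => <<A>>%MS)
          (mem (subspaces_avoiding K n))) /=; last first.
  move=> A; rewrite inU => /andP[fA AK0]; rewrite inE genmx_id eqxx.
  rewrite mxrank_gen (eqP fA) eqxx /=.
  by rewrite -mxrank_eq0 (cap_eqmx (genmxE A) (eqmx_refl K)) mxrank_eq0.
apply: eq_bigr => U; rewrite inE => /and3P[/eqP gU /eqP rU UK].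
rewrite mul1n.
have [A0 fA0 A0U] : exists2 A0 : 'M[k]_(n, d), row_free A0 & (A0 :=: U)%MS.
  by move: rU => <-; exists (row_base U); [exact: row_base_free|exact: eq_row_base].
have rf (X : 'M[k]_n) : row_free (X *m A0) = row_full X.
  by rewrite /row_free mxrankMfree.
rewrite -(card_imset _ (row_free_inj fA0)) -!sum1_card.
apply: eq_bigl => A; apply/idP/idP.
  move=> /imsetP[X]; rewrite inE -rf => fXA ->.
  have XA : (X *m A0 :=: A0)%MS.
    apply/eqmxP; rewrite submxMl /=; have [_] := mxrank_leqif_sup (submxMl X A0).
    by rewrite (eqP fXA) (eqP fA0) eqxx => <-.
  rewrite inU fXA /= -mxrank_eq0.
  rewrite (cap_eqmx (eqmx_trans XA A0U) (eqmx_refl K)) mxrank_eq0 UK /=.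
  by rewrite -gU; apply/eqP/eq_genmx; apply: eqmx_trans XA A0U.
rewrite inU => /andP[/andP[fA AK] /eqP AU].
have /submxP[X XE] : (A <= A0)%MS by rewrite A0U -AU genmxE.
by apply/imsetP; exists X; rewrite ?inE // -rf -XE.
Qed.

End FiniteFieldCounts.

(** * Lattices over k[[X]] containing a power of X *)

Section BoundedLattices.
Variable (k : finFieldType) (d : nat).
Local Notation q := #|k|.
Local Notation S := {fps k}.
Local Notation "'X" := (fpsX : S) : ring_scope.
Local Notation submodule := (@is_submodule S S idfun d).
Local Notation lattices := (@finite_index_submodules S S idfun d).
Local Notation red := (map_mx (@fps0 k)).
Implicit Types (N : set 'rV[S]_d) (v : 'rV[S]_d).

Local Notation submod_subgroup := (@submodule_subgroup S S idfun d _).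

Lemma red_lift l (u : 'M[k]_(l, d)) : red (map_mx (@fpsC k) u) = u.
Proof. by apply/matrixP => i j; rewrite !mxE. Qed.

Lemma red_eq0 v : red v = 0 -> exists w, v = 'X *: w.
Proof.
move=> v0; exists (map_mx (@fps_shift k 1) v); apply/rowP => i; rewrite !mxE.
by apply: fps0_eq0; have := congr1 (fun u : 'rV_d => u 0 i) v0; rewrite !mxE.
Qed.

Lemma redX v : red ('X *: v) = 0.
Proof. by apply/rowP => i; rewrite !mxE rmorphM /= mul0r. Qed.

Lemma scaleX_inj (u v : 'rV[S]_d) : 'X *: u = 'X *: v -> u = v.
Proof.
move=> E; apply/rowP => i; apply/eqP; rewrite -subr_eq0; apply/eqP.
apply: (@fpsXn_regular k 1); rewrite mulrC expr1 mulrBr.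
by have := congr1 (fun w : 'rV_d => w 0 i) E; rewrite !mxE => ->; rewrite subrr.
Qed.

(** The image of N in k^d. *)
Definition redspace N : 'M[k]_d :=
  (\sum_(w : 'rV[k]_d | `[< exists2 v, N v & red v = w >]) <<w>>)%MS.

Lemma redspaceP N (w : 'rV[k]_d) : submodule N ->
  (w <= redspace N)%MS <-> exists2 v, N v & red v = w.
Proof.
move=> [N0 ND NZ]; split; last first.
  move=> vw; have wP : `[< exists2 v, N v & red v = w >] by apply/asboolP.
  by apply: (sumsmx_sup w) => //; rewrite genmxE.
move=> /sub_sumsmxP[u ->].
apply: (big_ind (fun x : 'rV[k]_d => exists2 v, N v & red v = x)).
- by exists 0 => //; rewrite map_mx0.
- move=> _ _ [v Nv <-] [v' Nv' <-]; exists (v + v'); first exact: ND.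
  by rewrite map_mxD.
- move=> x /asboolP[v Nv <-].
  have /sub_rVP[c ->] : (u (red v) *m <<red v>>%MS <= red v)%MS.
    by apply: (submx_trans (submxMl _ _)); rewrite genmxE.
  exists (fpsC c *: v); first exact: (NZ (fpsC c)).
  by rewrite map_mxZ.
Qed.

(** The dimension of S^d / (N + X S^d), which is the minimal number of
    generators of S^d / N. *)
Definition corank N : nat := (d - \rank (redspace N))%N.

Definition colonX N : set 'rV[S]_d := [set v | N ('X *: v)].

Lemma sub_colonX N : submodule N -> N `<=` colonX N.
Proof. by move=> [_ _ NZ] v Nv; apply: (NZ 'X). Qed.

Lemma colonX_submodule N : submodule N -> submodule (colonX N).
Proof.
move=> [N0 ND NZ]; split; rewrite /colonX /=.
- by rewrite scaler0.
- by move=> u v Nu Nv; rewrite scalerDr; apply: ND.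
- by move=> a v Nv; rewrite scalerA mulrC -scalerA; apply: (NZ a).
Qed.

Lemma colonX_lattice N : lattices N -> lattices (colonX N).
Proof.
move=> [mN finN]; split; first exact: colonX_submodule.
apply: finite_indexW finN; last exact: sub_colonX.
  exact/submod_subgroup/colonX_submodule.
exact: submod_subgroup.
Qed.

(** S^d / (N + X S^d) has dimension corank N, and multiplication by X
    identifies S^d / (N : X) with (N + X S^d) / N. *)
Lemma colonX_reps N (J : finType) (t : J -> 'rV[S]_d) (Wc := (redspace N)^C%MS) :
  submodule N -> coset_reps setT (colonX N) t ->
  coset_reps setT N (fun uj : 'rV[k]_(\rank Wc) * J =>
    map_mx (@fpsC k) (uj.1 *m row_base Wc) + 'X *: t uj.2).
Proof.
move=> mN [_ tE tU]; have sN := submod_subgroup mN.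
set W := redspace N in Wc *.
pose M : set 'rV[S]_d := [set v | (red v <= W)%MS].
have sM : subgroup M.
  split=> [|u v|u]; rewrite /M /=.
  - by rewrite map_mx0 sub0mx.
  - by rewrite map_mxD; apply: addmx_sub.
  - by rewrite map_mxN eqmx_opp.
have NM : N `<=` M by move=> v Nv; apply/(redspaceP _ mN); exists v.
have sT : coset_reps setT M
    (fun u : 'rV[k]_(\rank Wc) => map_mx (@fpsC k) (u *m row_base Wc)).
  split=> // [v _|u u'].
    have : (red v <= W + Wc)%MS by rewrite submx_full // addsmx_compl_full.
    move=> /sub_addsmxP[[x y] /= vE].
    have : (y *m Wc <= row_base Wc)%MS by rewrite eq_row_base submxMl.
    move=> /submxP[z zE]; exists z.
    by rewrite /M /= map_mxB red_lift vE zE addrK submxMl.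
  rewrite /M /= map_mxB !red_lift -mulmxBl => uW.
  have : ((u - u') *m row_base Wc <= W :&: Wc)%MS.
    by rewrite sub_capmx uW -(eq_row_base Wc) submxMl.
  rewrite capmx_compl submx0 mulmx_free_eq0 ?row_base_free //.
  by rewrite subr_eq0 => /eqP.
have tT : coset_reps M N (fun j => 'X *: t j).
  split=> [j|v Mv|i j].
  - by rewrite /M /= redX sub0mx.
  - have [u Nu uv] : exists2 u, N u & red u = red v by apply/redspaceP.
    have [w wE] : exists w, v - u = 'X *: w.
      by apply: red_eq0; rewrite map_mxB uv subrr.
    have [j Nj] := tE w I; exists j.
    have -> : v - 'X *: t j = u + 'X *: (w - t j).
      by rewrite scalerBr -wE addrA addrCA subrr addr0.
    by case: mN => _ + _; apply.
  - by rewrite -scalerBr => /tU.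
exact: coset_reps_chain (@subgroupT _) sM sN NM (fun _ _ => I) sT tT.
Qed.

Lemma corankE N : \rank (redspace N)^C%MS = corank N.
Proof. by rewrite mxrank_compl. Qed.

Lemma index_colonX N : submodule N -> lattices (colonX N) ->
  lattices N /\ subm_index N = (q ^ corank N * subm_index (colonX N))%N.
Proof.
move=> mN [mN' finN']; have sN := submod_subgroup mN.
have [t tT] := subm_indexP (submod_subgroup mN') finN'.
have T := colonX_reps mN tT.
split; last first.
  by rewrite (subm_index_coset_reps sN T) card_prod card_mx mul1n card_ord corankE.
by split=> //; apply: coset_reps_finite_index T.
Qed.

Definition bounded_submodules m : set (set 'rV[S]_d) :=
  [set N | submodule N /\ forall v, N ('X ^+ m *: v)].

Lemma bounded_submodules0 : bounded_submodules 0 = [set setT].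
Proof.
apply/seteqP; split=> [N [_ N1]|_ ->] //.
by apply/seteqP; split=> // v _; have := N1 v; rewrite expr0 scale1r.
Qed.

Lemma bounded_colonX m N :
  bounded_submodules m.+1 N -> bounded_submodules m (colonX N).
Proof.
move=> [mN NX]; split; first exact: colonX_submodule.
by move=> v; rewrite /colonX /= scalerA -exprS.
Qed.

Lemma index_setT : lattices setT /\ subm_index [set: 'rV[S]_d] = 1%N.
Proof.
have T : coset_reps setT [set: 'rV[S]_d] (fun _ : 'I_1 => 0).
  by split=> // [v _|i j _]; [exists ord0|rewrite !ord1].
split; last by rewrite (subm_index_coset_reps (@subgroupT _) T) card_ord.
by split=> //; apply: coset_reps_finite_index T.
Qed.

Lemma bounded_lattice m N : bounded_submodules m N -> lattices N.
Proof.
elim: m N => [|m IHm] N; first by rewrite bounded_submodules0 => ->; case: index_setT.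
by move=> bN; have [] := index_colonX (proj1 bN) (IHm _ (bounded_colonX bN)).
Qed.

Lemma redspace_setT : (redspace setT :=: 1%:M)%MS.
Proof.
apply/eqmxP; rewrite submx1 /=; apply/row_subP => i.
by apply/redspaceP => //; exists (map_mx (@fpsC k) (row i 1%:M)); rewrite ?red_lift.
Qed.

Lemma corank_setT : corank setT = 0%N.
Proof. by rewrite /corank (eqmx_rank (introT eqmxP redspace_setT)) mxrank1 subnn. Qed.

Lemma redspaceS N N' : submodule N -> submodule N' -> N `<=` N' ->
  (redspace N <= redspace N')%MS.
Proof.
move=> mN mN' NN'; apply/rV_subP => v /(redspaceP _ mN)[u Nu <-].
by apply/(redspaceP _ mN'); exists u => //; apply: NN'.
Qed.

Lemma corank_colonX N : submodule N -> (corank (colonX N) <= corank N)%N.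
Proof.
move=> mN; apply/leq_sub2l/mxrankS/redspaceS => //; first exact: colonX_submodule.
exact: sub_colonX.
Qed.

(** The lattices N with (N : X) = N' = S^d g lie between X N' and N', and meet
    X S^d in X N'. So they are the preimages in N' of the subspaces of
    N' / X N' = k^d that avoid the kernel K of N' / X N' -> S^d / X S^d. *)
Section Fibre.
Variables (N' : set 'rV[S]_d) (g : 'M[S]_d).
Hypothesis gI : forall v, v *m g = 0 -> v = 0.
Hypothesis gE : N' = [set v *m g | v in setT].

Let K := kermx (red g).

Definition lift_subspace (U : 'M[k]_d) : set 'rV[S]_d :=
  [set v *m g | v in [set v | (red v <= U)%MS]].

Lemma gI2 u v : u *m g = v *m g -> u = v.
Proof.
by move=> E; apply/eqP; rewrite -subr_eq0; apply/eqP/gI; rewrite mulmxBl E subrr.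
Qed.

Lemma lift_subspace_submodule U : submodule (lift_subspace U).
Proof.
split=> [|_ _ [u uU <-] [v vU <-]|a _ [v vU <-]].
- by exists 0; rewrite /= ?mul0mx // map_mx0 sub0mx.
- by exists (u + v); rewrite ?mulmxDl //= map_mxD addmx_sub.
- by exists (a *: v); rewrite /= -?scalemxAl // map_mxZ scalemx_sub.
Qed.

Lemma lift_subspace_colonX U : (U :&: K)%MS == 0 -> colonX (lift_subspace U) = N'.
Proof.
move=> UK; rewrite gE; apply/seteqP; split=> [w [v /= vU vE]|_ [v _ <-]]; last first.
  by exists ('X *: v); rewrite /= ?scalemxAl // redX sub0mx.
have : (red v <= U :&: K)%MS.
  by rewrite sub_capmx vU; apply/sub_kermxP; rewrite -map_mxM vE redX.
rewrite (eqP UK) submx0 => /eqP/red_eq0[v' v'E]; exists v' => //.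
by apply: scaleX_inj; rewrite -vE v'E -scalemxAl.
Qed.

Lemma lift_subspaceS U U' :
  lift_subspace U `<=` lift_subspace U' -> (U <= U')%MS.
Proof.
move=> UU'; apply/rV_subP => v vU.
have [|u uU' /gI2 uE] := UU' (map_mx (@fpsC k) v *m g).
  by exists (map_mx (@fpsC k) v); rewrite //= red_lift.
by rewrite -[v]red_lift -uE.
Qed.

Lemma lift_subspace_surj N : submodule N -> colonX N = N' ->
  exists U, [/\ <<U>>%MS = U, (U :&: K)%MS == 0 & N = lift_subspace U].
Proof.
move=> mN NX; pose M : set 'rV[S]_d := [set v | N (v *m g)].
have [N0 ND NZ] := mN.
have mM : submodule M.
  split; rewrite /M /= ?mul0mx //.
    by move=> u v Nu Nv; rewrite mulmxDl; apply: ND.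
  by move=> a v Nv; rewrite -scalemxAl; apply: (NZ a).
exists <<redspace M>>%MS; split; first by rewrite genmx_id.
  rewrite -submx0; apply/rV_subP => w; rewrite sub_capmx genmxE => /andP[].
  move=> /(redspaceP _ mM)[v Nv <-] /sub_kermxP; rewrite -map_mxM => /red_eq0[u uE].
  have : N' u by rewrite -NX /colonX /= -uE.
  rewrite gE => -[u' _ u'E]; have -> : v = 'X *: u'.
    by apply: gI2; rewrite -scalemxAl u'E uE.
  by rewrite redX sub0mx.
apply/seteqP; split=> [v Nv|_ [v /= vM <-]].
  have := sub_colonX mN Nv; rewrite NX gE => -[u _ uE]; exists u => //=.
  by rewrite genmxE; apply/(redspaceP _ mM); exists u; rewrite ?uE // /M /= uE.
move: vM; rewrite genmxE => /(redspaceP _ mM)[u Nu uv].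
have [w wE] : exists w, v - u = 'X *: w by apply: red_eq0; rewrite map_mxB uv subrr.
rewrite -(subrK u v) wE mulmxDl; apply: ND => //.
have : colonX N (w *m g) by rewrite NX gE; exists w.
by rewrite /colonX /= scalemxAl.
Qed.

Lemma redspace_lift U : (redspace (lift_subspace U) :=: U *m red g)%MS.
Proof.
apply/eqmxP/andP; split; apply/rV_subP => v.
  move=> /(redspaceP _ (lift_subspace_submodule U))[_ [u /= uU <-] <-].
  by rewrite map_mxM submxMr.
move=> /submxP[u ->]; apply/(redspaceP _ (lift_subspace_submodule U)).
exists (map_mx (@fpsC k) (u *m U) *m g); last by rewrite map_mxM red_lift mulmxA.
by exists (map_mx (@fpsC k) (u *m U)); rewrite //= red_lift submxMl.
Qed.

Lemma corank_lift U : (U :&: K)%MS == 0 -> corank (lift_subspace U) = (d - \rank U)%N.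
Proof.
move=> UK; rewrite /corank (eqmx_rank (introT eqmxP (redspace_lift U))).
by rewrite -(mxrank_mul_ker U (red g)) -/K (eqP UK) mxrank0 addn0.
Qed.

Lemma rank_ker_red : \rank K = corank N'.
Proof.
rewrite mxrank_ker /corank; congr (_ - _)%N; apply: eqmx_rank.
have -> : N' = lift_subspace 1%:M.
  rewrite gE; apply/seteqP; split=> _ [v vP <-]; exists v => //=.
  by rewrite submx1.
by apply/eqmxP/eqmx_sym; rewrite -[X in (_ :=: X)%MS]mul1mx; apply: redspace_lift.
Qed.

End Fibre.

(** The number of subspaces of k^d of dimension d - r1 that avoid a given
    subspace of dimension r; the division is exact. *)
Definition fibre_count r r1 : nat :=
  ((\prod_(j < d - r1) (q ^ d - q ^ (r + j))) %/
   (\prod_(j < d - r1) (q ^ (d - r1) - q ^ j)))%N.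

Lemma card_fibre l (K : 'M[k]_(l, d)) r1 :
  #|subspaces_avoiding K (d - r1)%N| = fibre_count (\rank K) r1.
Proof.
rewrite /fibre_count -card_subspaces_avoiding mulnK //.
apply: prodn_gt0 => j; rewrite subn_gt0 ltn_exp2l //.
exact: card_finNzRing_gt1.
Qed.

(** The lattice (N : X) has corank at most that of N. The lattices N over a
    given N' = (N : X) with a given corank r are as many as the subspaces of
    dimension d - r of k^d that avoid the kernel of the reduction of a basis of
    N', and this kernel has dimension corank N'. *)
Lemma esum_bounded_step (R : realType) m (f : nat -> nat -> \bar R) :
  (forall r l, 0 <= f r l)%E ->
  (\esum_(N in bounded_submodules m.+1) f (corank N) (subm_index N) =
   \esum_(N in bounded_submodules m)
     \esum_(r in [set r | (corank N <= r <= d)%N])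
       ((fibre_count (corank N) r)%:R%:E * f r (q ^ r * subm_index N)%N))%E.
Proof.
move=> f0; rewrite [RHS]esum_esum; last by move=> *; rewrite mule_ge0 // lee_fin.
pose E := bounded_submodules m `*`` (fun N => [set r | (corank N <= r <= d)%N]).
rewrite (esum_fibre (p := fun N => (colonX N, corank N)) (E := E)) //; last first.
  move=> N bN; split => /=; first exact: bounded_colonX.
  by rewrite corank_colonX ?leq_subr //; case: bN.
apply: eq_esum => -[N' r] [/= bN' /andP[r1 r2]].
have lN' := bounded_lattice bN'.
have [g [gI gE]] := lattice_free (fps_principal_system k) lN'.
rewrite -(rank_ker_red gE) -card_fibre.
have inD U : U \in subspaces_avoiding (kermx (red g)) (d - r)%N ->
    [/\ <<U>>%MS = U, \rank U = (d - r)%N & (U :&: kermx (red g))%MS == 0].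
  by rewrite inE => /and3P[/eqP -> /eqP ->].
apply: (esum_cst_finset (r := lift_subspace g)) => //.
- split.
  + move=> U /inD[_ rU UK]; split.
      split; first exact: lift_subspace_submodule.
      move=> v; have [_] := bN'; rewrite -(lift_subspace_colonX gE UK).
      by move=> /(_ v); rewrite /colonX /= scalerA -exprS.
    by rewrite /= (lift_subspace_colonX gE UK) corank_lift // rU subKn.
  + move=> U V /set_mem/inD[gU _ _] /set_mem/inD[gV _ _] /seteqP[UV VU].
    by rewrite -gU -gV; apply/genmxP; rewrite !(lift_subspaceS gI).
  + move=> N [[mN bN] /= [NX rN]].
    have [U [gU UK NE]] := lift_subspace_surj gI gE mN NX.
    exists U => //; rewrite /= inE gU eqxx UK andbT /=.
    by move: rN; rewrite NE corank_lift // => <-; rewrite subKn // rank_leq_row.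
- move=> N [[mN bN] /= [NX rN]].
  have lX : lattices (colonX N) by rewrite NX.
  by have [_ ->] := index_colonX mN lX; rewrite NX rN.
Qed.

End BoundedLattices.

(** * Partitions in a box *)

Section Partitions.
Implicit Types (mu : seq nat) (m d r : nat).

Definition box m d : set (seq nat) :=
  [set mu | is_partition mu /\ contained mu (nseq d m)].

Lemma conj_part1 mu : 0%N \notin mu -> conj_part mu 1 = size mu.
Proof.
move=> mu0; rewrite /conj_part; apply/eqP; rewrite -all_count; apply/allP => x.
by case: x => // x0; rewrite x0 in mu0.
Qed.

Lemma geq_trans : transitive geq.
Proof. by move=> b a c /= ba cb; apply: leq_trans cb ba. Qed.

Lemma boxP m d mu :
  box m d mu <-> [/\ is_partition mu, (size mu <= d)%N & all (leq^~ m) mu].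
Proof.
split=> [[pmu cmu]|[pmu smu mum]].
  have smu : (size mu <= d)%N.
    rewrite leqNgt; apply/negP => ds; have := cmu d.
    rewrite [nth 0 (nseq d m) d]nth_default ?size_nseq // leqn0 => /eqP nd.
    by case/andP: pmu => _ /negP; apply; rewrite -nd mem_nth.
  split=> //; apply/(all_nthP 0) => i imu; have := cmu i.
  by rewrite nth_nseq (leq_trans imu smu).
split=> // i; rewrite nth_nseq; have [imu|imu] := ltnP i (size mu).
  by rewrite (leq_trans imu smu); apply: (all_nthP 0 mum).
by rewrite nth_default.
Qed.

Definition add_column r mu : seq nat :=
  map succn mu ++ nseq (r - size mu) 1%N.

Definition remove_column mu : seq nat := [seq x.-1 | x <- mu & (1 < x)%N].

Lemma add_columnK r mu : 0%N \notin mu -> remove_column (add_column r mu) = mu.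
Proof.
rewrite /remove_column /add_column filter_cat map_cat.
have -> l : [seq x <- nseq l 1%N | (1 < x)%N] = [::] by elim: l.
rewrite cats0; elim: mu => [|x mu IHmu] //=.
by rewrite inE negb_or; case: x => // x /= ?; rewrite IHmu.
Qed.

Lemma remove_columnK mu :
  is_partition mu -> add_column (size mu) (remove_column mu) = mu.
Proof.
rewrite /is_partition; elim: mu => [|x mu IHmu] //.
rewrite inE negb_or /= => /andP[pmu /andP[x0 mu0]].
have smu := path_sorted pmu.
have [x1|x1] := ltnP 1%N x.
  rewrite /remove_column /= x1 /= /add_column /= subSS prednK ?(ltnW x1) //.
  by congr (_ :: _); apply: IHmu; rewrite smu.
have -> : x = 1%N by case: x x0 x1 {pmu} => [|[]].
have mu1 : mu = nseq (size mu) 1%N.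
  apply/all_pred1P/allP => y ymu /=.
  have : all (geq x) mu := order_path_min geq_trans pmu.
  move=> /allP/(_ _ ymu) /= yx; rewrite eqn_leq (leq_trans yx x1) lt0n.
  by apply: contraNneq mu0 => <-.
by rewrite mu1 /remove_column /= size_nseq;
  have -> : [seq y <- nseq (size mu) 1%N | (1 < y)%N] = [::] by elim: (size mu).
Qed.

Lemma size_add_column r mu : (size mu <= r)%N -> size (add_column r mu) = r.
Proof. by move=> ?; rewrite size_cat size_map size_nseq subnKC. Qed.

Lemma add_column_positive r mu : 0%N \notin add_column r mu.
Proof.
rewrite mem_cat negb_or; apply/andP; split; first by apply/negP => /mapP[].
by apply/negP => /nseqP[].
Qed.

Lemma conj_add_column1 r mu :
  (size mu <= r)%N -> conj_part (add_column r mu) 1 = r.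
Proof. by move=> ?; rewrite conj_part1 ?add_column_positive ?size_add_column. Qed.

Lemma conj_add_columnS r mu i :
  conj_part (add_column r mu) i.+2 = conj_part mu i.+1.
Proof.
rewrite /conj_part count_cat count_map count_nseq /= mul0n addn0.
by apply: eq_count => x.
Qed.

Lemma sumn_add_column r mu :
  (size mu <= r)%N -> sumn (add_column r mu) = (r + sumn mu)%N.
Proof.
move=> smu; rewrite sumn_cat sumn_nseq mul1n.
have -> : sumn (map succn mu) = (size mu + sumn mu)%N.
  by elim: mu {smu} => //= x mu ->; lia.
by rewrite addnAC subnKC.
Qed.

Lemma add_column_partition r mu : is_partition mu -> is_partition (add_column r mu).
Proof.
move=> /andP[smu mu0]; rewrite /is_partition add_column_positive andbT.
move: smu; rewrite !(sorted_pairwise geq_trans) pairwise_cat pairwise_map => smu.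
apply/and3P; split.
- by apply/allrelP => _ _ /mapP[x _ ->] /nseqP[-> _].
- by apply: sub_pairwise smu => x y.
- by elim: (r - _)%N => //= l ->; rewrite andbT all_nseq orbT.
Qed.

Lemma size_partition_le mu : 0%N \notin mu -> (size mu <= sumn mu)%N.
Proof.
elim: mu => //= x mu IHmu; rewrite inE negb_or => /andP[x0 /IHmu].
by move: (sumn mu) => s; rewrite -addn1 addnC; apply: leq_add; case: x x0.
Qed.

Lemma box0 d : box 0 d = [set [::]].
Proof.
apply/seteqP; split=> [[|x mu] /boxP|_ ->] //.
  move=> [/andP[_]]; rewrite inE negb_or => /andP[x0 _] _ /= /andP[+ _].
  by case: x x0.
by apply/boxP.
Qed.

(** Lengths of columns decrease, so the new first column is at least as long as
    the old one. *)
Lemma add_column_bij m d :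
  set_bij (box m d `*`` (fun mu => [set r | (conj_part mu 1 <= r <= d)%N]))
          (box m.+1 d) (fun x => add_column x.2 x.1).
Proof.
split.
- move=> [mu r] /= [/boxP[pmu smu mum] /andP[mur rd]].
  have /andP[_ mu0] := pmu; rewrite conj_part1 // in mur.
  apply/boxP; split; first exact: add_column_partition.
    by rewrite size_add_column.
  rewrite all_cat all_map; apply/andP; split; last by rewrite all_nseq orbT.
  by apply: sub_all mum.
- move=> [mu r] [mu' r'] /set_mem/= [/boxP[/andP[_ mu0] _ _] /andP[mur _]].
  move=> /set_mem/= [/boxP[/andP[_ mu0'] _ _] /andP[mur' _]] E.
  rewrite !conj_part1 // in mur mur'.
  congr (_, _); first by rewrite -(add_columnK r mu0) E add_columnK.
  by rewrite -(size_add_column mur) E size_add_column.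
- move=> mu /boxP[pmu smu mum]; have /andP[smu' mu0] := pmu.
  have rmu0 : 0%N \notin remove_column mu.
    by apply/negP => /mapP[x]; rewrite mem_filter; case: x => [|[|x]].
  exists (remove_column mu, size mu); last by rewrite /= remove_columnK.
  have sr : (size (remove_column mu) <= size mu)%N.
    by rewrite size_map size_filter count_size.
  split=> /=; last by rewrite conj_part1 // sr.
  apply/boxP; split; last 2 first.
  + exact: leq_trans smu.
  + apply/allP => y /mapP[x]; rewrite mem_filter => /andP[x1 xmu] ->.
    by have := allP mum _ xmu; case: (x : nat) x1.
  + rewrite /is_partition rmu0 andbT sorted_map.
    apply: (sub_sorted (e := geq)); first by move=> x y /=; case: x y => [|x] [|y].
    by apply: sorted_filter smu'; apply: geq_trans.
Qed.

End Partitions.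

(** * The number of lattices of each type *)

Section TypeCount.
Variable (k : finFieldType).
Local Notation q := #|k|.

(** The number of lattices K of S^d with S^d / K of type mu, built column by
    column: mu'_i is the corank of (K : X^(i-1)). *)
Definition type_count d m mu : nat :=
  (\prod_(1 <= i < m.+1) fibre_count k d (conj_part mu i.+1) (conj_part mu i))%N.

Lemma type_count_add_column d m mu r : (size mu <= r)%N -> 0%N \notin mu ->
  type_count d m.+1 (add_column r mu) =
  (fibre_count k d (conj_part mu 1) r * type_count d m mu)%N.
Proof.
move=> mur mu0; rewrite /type_count big_nat_recl // conj_add_columnS.
rewrite conj_add_column1 //; congr (_ * _)%N.
by apply: eq_big_nat => -[|i] // _; rewrite !conj_add_columnS.
Qed.

(** Passing from N to (N : X) removes the first column of the type of S^d / N,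
    whose length is corank N; so the recursion over m on the left is the one of
    partitions in boxes on the right. *)
Lemma esum_bounded (R : realType) d m (f : nat -> nat -> \bar R) :
  (forall r l, 0 <= f r l)%E ->
  (\esum_(N in @bounded_submodules k d m) f (corank N) (subm_index N) =
   \esum_(mu in box m d)
     ((type_count d m mu)%:R%:E * f (conj_part mu 1) (q ^ sumn mu)%N))%E.
Proof.
elim: m f => [|m IHm] f f0.
  rewrite bounded_submodules0 box0 !esum_set1 ?mule_ge0 ?lee_fin //.
  rewrite corank_setT /type_count big_geq // mul1e.
  by rewrite (proj2 (@index_setT k d)).
rewrite esum_bounded_step // (IHm (fun r l => \esum_(r1 in [set r1 | (r <= r1 <= d)%N])
   ((fibre_count k d r r1)%:R%:E * f r1 (q ^ r1 * l)%N))%E); last first.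
  by move=> r l; apply: esum_ge0 => *; rewrite mule_ge0 ?lee_fin.
rewrite (reindex_esum _ _ _ _ (@add_column_bij m d)).
rewrite -(@esum_esum _ _ _ _ _ (fun mu r =>
   ((type_count d m.+1 (add_column r mu))%:R%:E *
     f (conj_part (add_column r mu) 1) (q ^ sumn (add_column r mu))%N)%E)); last first.
  by move=> *; rewrite mule_ge0 ?lee_fin.
apply: eq_esum => mu /boxP[/andP[_ mu0] _ _].
have tc0 : (0 <= (type_count d m mu)%:R :> R)%R by [].
rewrite -esumZl //; last by move=> *; rewrite mule_ge0 ?lee_fin.
apply: eq_esum => r /= /andP[mur _]; have mur' := mur.
rewrite conj_part1 // in mur'.
rewrite type_count_add_column // sumn_add_column // conj_add_column1 //.
by rewrite muleA expnD -EFinM -natrM mulnC.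
Qed.

(** ** Closed forms *)

Section ClosedForms.
Variable F : numFieldType.
Local Notation Q := (q%:R : F).

Lemma qF_gt1 : 1 < Q.
Proof. by rewrite ltr1n card_finNzRing_gt1. Qed.

Lemma qF_neq0 : Q != 0.
Proof. by rewrite gt_eqF // (lt_trans _ qF_gt1). Qed.

Lemma qpoch_neq0 n : qpoch Q^-1 Q^-1 n != 0.
Proof.
apply/prodf_neq0 => j _; rewrite -exprS subr_eq0 eq_sym exprVn invr_eq1.
by rewrite gt_eqF // exprn_egt1 // qF_gt1.
Qed.

(** Each factor q^(r + N) - q^(r + j) is q^(r + N) (1 - q^-(N - j)), and the
    second factors are those of (q^-1; q^-1)_N of index at least N - n. *)
Lemma frames_qpoch r N n : (n <= N)%N ->
  (\prod_(j < n) (q ^ (r + N) - q ^ (r + j)))%N%:R =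
  Q ^+ ((r + N) * n) * (qpoch Q^-1 Q^-1 N / qpoch Q^-1 Q^-1 (N - n)).
Proof.
move=> nN; rewrite mulrA; apply: (canRL (mulfK (qpoch_neq0 _))).
elim: n nN => [|n IHn] nN.
  by rewrite big_ord0 muln0 expr0 !mul1r subn0.
rewrite big_ord_recr natrM /=.
rewrite natrB ?leq_pexp2l ?leq_add2l ?(ltnW nN) //; last first.
  exact/ltnW/card_finNzRing_gt1.
rewrite mulnS exprD -mulrA -(IHn (ltnW nN)) !natrX.
have -> : (N - n = (N - n.+1).+1)%N by lia.
set l := (N - n.+1)%N.
have -> : qpoch Q^-1 Q^-1 l.+1 = qpoch Q^-1 Q^-1 l * (1 - Q^-1 * Q^-1 ^+ l).
  by rewrite /qpoch big_ord_recr.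
have -> : Q ^+ (r + N) - Q ^+ (r + n) = Q ^+ (r + N) * (1 - Q^-1 * Q^-1 ^+ l).
  rewrite mulrBr mulr1 -exprS exprVn; congr (_ - _).
  have -> : (r + N = (r + n) + l.+1)%N by rewrite /l; lia.
  by rewrite [in RHS]exprD mulfK // expf_neq0 // qF_neq0.
by ring.
Qed.

Lemma fibre_countE d r r1 : (r <= r1 <= d)%N ->
  (fibre_count k d r r1)%:R =
  Q ^+ (r1 * (d - r1)) * qbinom Q^-1 (d - r) (d - r1).
Proof.
move=> /andP[rr1 r1d]; set n := (d - r1)%N; set N := (d - r)%N.
have nN : (n <= N)%N by rewrite /n /N; lia.
have dE : d = (r + N)%N by rewrite /N; lia.
have D0 : (0 < \prod_(j < n) (q ^ n - q ^ j))%N.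
  apply: prodn_gt0 => j; rewrite subn_gt0 ltn_exp2l //.
  exact: card_finNzRing_gt1.
have DE : (\prod_(j < n) (q ^ n - q ^ j))%N%:R = Q ^+ (n * n) * qpoch Q^-1 Q^-1 n.
  by have := frames_qpoch 0 (leqnn n); rewrite subnn [qpoch _ _ 0]big_ord0 divr1.
have := frames_qpoch r nN; rewrite -dE.
have <- : (fibre_count k d r r1 * \prod_(j < n) (q ^ n - q ^ j) =
           \prod_(j < n) (q ^ d - q ^ (r + j)))%N.
  (* exact division: a coordinate subspace of dimension r realizes the count *)
  have rd : (r <= d)%N by apply: leq_trans r1d.
  have := card_subspaces_avoiding (pid_mx r : 'M[k]_d) n.
  by rewrite {1}/n card_fibre !rank_pid_mx.
rewrite natrM DE => E; apply: (mulIf (x := Q ^+ (n * n) * qpoch Q^-1 Q^-1 n)).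
  by rewrite mulf_neq0 ?qpoch_neq0 // expf_neq0 // qF_neq0.
rewrite E /qbinom.
have -> : (d * n = r1 * n + n * n)%N by rewrite -mulnDl /n; congr (_ * _)%N; lia.
by rewrite exprD; field; rewrite !qpoch_neq0.
Qed.

Lemma conj_part_anti mu i : (conj_part mu i.+1 <= conj_part mu i)%N.
Proof. by apply: sub_count => x /ltnW. Qed.

Lemma conj_part_le m d mu i : box m d mu -> (conj_part mu i <= d)%N.
Proof. by move=> /boxP[_ smu _]; apply: leq_trans (count_size _ _) smu. Qed.

(** Conjugate parts satisfy mu'_(i+1) <= mu'_i <= d, and the powers of q add up
    to the exponent of the skew Hall polynomial. *)
Lemma type_countE d m mu : box m d mu ->
  (type_count d m mu)%:R = skew_hall (nseq d m) mu Q.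
Proof.
move=> bmu; rewrite /skew_hall /type_count natr_prod.
have [d0|d0] := posnP d.
  rewrite big1_seq; last by move=> i _; rewrite /fibre_count d0 !sub0n !big_ord0.
  by rewrite d0 /= !big_geq // expr0 mul1r.
have -> : head 0%N (nseq d m) = m by case: (d) d0.
rewrite (big_morph (fun n => Q ^+ n) (exprD Q) (expr0 Q)) -big_split /=.
apply: eq_big_nat => i /andP[i1 im].
have -> : conj_part (nseq d m) i = d.
  by rewrite /conj_part count_nseq -ltnS im mul1n.
by rewrite fibre_countE // conj_part_anti (conj_part_le _ bmu).
Qed.

End ClosedForms.
End TypeCount.

(** * Submodules over a subring, sorted by the lattice they generate *)

Section Span.
Variables (A B : comNzRingType) (iota : {rmorphism A -> B}).
Variables (J : choiceType) (p : J -> B) (n : J -> nat).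
Hypothesis ps : principal_system p n.
Variable d : nat.
Implicit Types N L : set 'rV[B]_d.

Local Notation Bsubmodule := (@is_submodule B B idfun d).
Local Notation Blattices := (@finite_index_submodules B B idfun d).
Local Notation Alattices := (@finite_index_submodules A B iota d).

Definition span N : set 'rV[B]_d :=
  [set v | forall L, Bsubmodule L -> N `<=` L -> L v].

Definition spanning_lattices : set (set 'rV[B]_d) :=
  [set N | Alattices N /\ span N = setT].

Lemma sub_span N : N `<=` span N.
Proof. by move=> v Nv L _; apply. Qed.

Lemma span_submodule N : Bsubmodule (span N).
Proof.
split=> [L [L0 _ _] _ //|u v uN vN L mL NL|a v vN L mL NL].
  by have [_ LD _] := mL; apply: LD; [apply: uN|apply: vN].
by have [_ _ LZ] := mL; apply: LZ; apply: vN.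
Qed.

Lemma span_lattice N : Alattices N -> Blattices (span N).
Proof.
move=> [mN finN]; split; first exact: span_submodule.
apply: finite_indexW finN; last exact: sub_span.
  exact/(@submodule_subgroup B B idfun)/span_submodule.
exact: submodule_subgroup mN.
Qed.

Section Image.
Variable g : 'M[B]_d.
Hypothesis gI : forall v : 'rV[B]_d, v *m g = 0 -> v = 0.
Let phi : {additive 'rV[B]_d -> 'rV[B]_d} := mulmxr g.

Lemma phi_inj : injective phi.
Proof.
move=> u v /= E; apply/eqP; rewrite -subr_eq0; apply/eqP/gI.
by rewrite mulmxBl E subrr.
Qed.

Lemma image_submodule (C : comNzRingType) (f : C -> B) N :
  is_submodule f N -> is_submodule f (phi @` N).
Proof.
move=> [N0 ND NZ]; split.
- by exists 0; rewrite // raddf0.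
- by move=> _ _ [u Nu <-] [v Nv <-]; exists (u + v); rewrite ?raddfD //; apply: ND.
- move=> a _ [v Nv <-]; exists (f a *: v); first exact: NZ.
  by rewrite /= scalemxAl.
Qed.

Lemma preimage_submodule (C : comNzRingType) (f : C -> B) N :
  is_submodule f N -> is_submodule f (phi @^-1` N).
Proof.
move=> [N0 ND NZ]; split=> [|u v|a v]; rewrite /= ?mul0mx // ?mulmxDl -?scalemxAl.
- exact: ND.
- exact: NZ.
Qed.

Lemma image_preimage N : N `<=` phi @` setT -> phi @` (phi @^-1` N) = N.
Proof.
move=> NT; apply/seteqP; split=> [_ [v Nv <-] //|v Nv].
by have [u _ uE] := NT v Nv; exists u => //; rewrite /= -uE in Nv.
Qed.

Lemma span_image N : span (phi @` N) = phi @` span N.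
Proof.
apply/seteqP; split=> [v|_ [v vN <-] L mL NL].
  apply; first exact/image_submodule/span_submodule.
  by move=> _ [u Nu <-]; exists u => //; apply: sub_span.
apply: (vN (phi @^-1` L)); first exact: preimage_submodule.
by move=> u Nu; apply: NL; exists u.
Qed.

Lemma index_image N : Alattices N -> Blattices (phi @` setT) ->
  Alattices (phi @` N) /\
  subm_index (phi @` N) = (subm_index (phi @` setT) * subm_index N)%N.
Proof.
move=> [mN finN] [mL finL]; have sN := submodule_subgroup mN.
have sL := @submodule_subgroup B B idfun _ _ mL.
have [r rT] := subm_indexP sN finN; have [s sT] := subm_indexP sL finL.
have sN' := subgroup_image phi sN.
have NL : phi @` N `<=` phi @` setT by apply: image_subset.
have T := coset_reps_chain (@subgroupT _) sL sN' NL (fun _ _ => I) sT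
  (coset_reps_image phi_inj rT).
split; last by rewrite (subm_index_coset_reps sN' T) card_prod !card_ord.
by split; [apply: image_submodule|apply: coset_reps_finite_index T].
Qed.

Lemma index_preimage N : Alattices N -> Alattices (phi @^-1` N).
Proof.
move=> [mN finN]; have sN := submodule_subgroup mN.
split; first exact: preimage_submodule.
apply: (finite_index_preimage (phi := phi) sN _ _ finN) => //.
exact: (subgroup_preimage phi sN).
Qed.

Lemma image_bij : Blattices (phi @` setT) ->
  set_bij spanning_lattices (Alattices `&` span @^-1` [set phi @` setT])
    (fun N => phi @` N).
Proof.
move=> lL; split.
- move=> N [lN sN]; split; first by have [] := index_image lN lL.
  by rewrite /= span_image sN.
- move=> N N' _ _ NN'; apply/seteqP; split=> v Nv.
    have : (phi @` N') (phi v) by rewrite -NN'; exists v.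
    by move=> [u N'u /phi_inj <-].
  have : (phi @` N) (phi v) by rewrite NN'; exists v.
  by move=> [u N'u /phi_inj <-].
- move=> N [lN /= sN]; exists (phi @^-1` N); last first.
    by apply: image_preimage; rewrite -sN; apply: sub_span.
  split; first exact: index_preimage.
  apply/seteqP; split=> // v _; have : span N (phi v) by rewrite sN; exists v.
  rewrite -{1}(@image_preimage N); last by rewrite -sN; apply: sub_span.
  by rewrite span_image => -[u uN /phi_inj <-].
Qed.

End Image.

(** The lattice generated by N is free, say B^d g, and N becomes a spanning
    submodule in the coordinates given by g. *)
Lemma esum_by_span (R : realType) (w : nat -> \bar R) : (forall i, 0 <= w i)%E ->
  (\esum_(N in Alattices) w (subm_index N) =
   \esum_(L in Blattices) \esum_(N in spanning_lattices)
     w (subm_index L * subm_index N)%N)%E.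
Proof.
move=> w0; rewrite (esum_fibre (p := span) (E := Blattices)) //; last first.
  exact: span_lattice.
apply: eq_esum => L lL; have [g [gI LE]] := lattice_free ps lL.
have LE' : L = (mulmxr g : {additive 'rV[B]_d -> 'rV[B]_d}) @` setT by [].
rewrite LE' in lL *; rewrite (reindex_esum _ _ _ _ (image_bij gI lL)).
by apply: eq_esum => N [lN _]; have [_ ->] := index_image gI lN lL.
Qed.

End Span.

(** * Spanning lattices over the ring of pairs congruent modulo X^m *)

Section SpanningLattices.
Variables (k : finFieldType) (A B : comNzRingType) (iota : {rmorphism A -> B}).
Variables (sigma : {rmorphism {fps k} -> B}) (e : B) (m d : nat).
Hypothesis sp : split_ring sigma e.
Local Notation S := {fps k}.
Local Notation "'X" := (fpsX : S) : ring_scope.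
Local Notation spair := (spair sigma e).

(** The image of iota consists of the pairs congruent modulo X^m. *)
Hypothesis iota_pair : forall a, exists f g, iota a = spair f (f + 'X ^+ m * g).
Hypothesis pair_iota : forall f g, exists a, iota a = spair f (f + 'X ^+ m * g).

Implicit Types (u v : 'rV[S]_d) (N : set 'rV[B]_d).
Local Notation Ssubmodule := (@is_submodule S S idfun d).
Local Notation Bsubmodule := (@is_submodule B B idfun d).
Local Notation submodule := (@is_submodule A B iota d).
Local Notation red := (map_mx (@fps0 k)).

Definition vpair u v : 'rV[B]_d := \row_i spair (u 0 i) (v 0 i).

Lemma vpairD u v u' v' : vpair u v + vpair u' v' = vpair (u + u') (v + v').
Proof. by apply/rowP => i; rewrite !mxE spairD. Qed.

Lemma vpairN u v : - vpair u v = vpair (- u) (- v).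
Proof. by apply/rowP => i; rewrite !mxE spairN. Qed.

Lemma vpairB u v u' v' : vpair u v - vpair u' v' = vpair (u - u') (v - v').
Proof. by rewrite vpairN vpairD. Qed.

Lemma vpairZ f g u v : spair f g *: vpair u v = vpair (f *: u) (g *: v).
Proof. by apply/rowP => i; rewrite !mxE (spairM sp). Qed.

Lemma vpair0 : vpair 0 0 = 0.
Proof. by apply/rowP => i; rewrite !mxE spair00. Qed.

Lemma vpairP (x : 'rV[B]_d) : exists u v, x = vpair u v.
Proof.
have xP i : exists fg : S * S, x 0 i = spair fg.1 fg.2.
  by have [f [g ->]] := spairP sp (x 0 i); exists (f, g).
have [h hE] := choice xP.
by exists (\row_i (h i).1), (\row_i (h i).2); apply/rowP => i; rewrite !mxE hE.
Qed.

Lemma vpair_inj u v u' v' : vpair u v = vpair u' v' -> u = u' /\ v = v'.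
Proof.
move=> /rowP E; have E' i := E i.
by split; apply/rowP => i; have := E' i; rewrite !mxE => /(spair_inj sp)[].
Qed.

Lemma submodule_scale N f g x :
  submodule N -> N x -> N (spair f (f + 'X ^+ m * g) *: x).
Proof. by move=> [_ _ NZ] Nx; have [a <-] := pair_iota f g; apply: NZ. Qed.

Lemma submodule_scale_diag N f u v :
  submodule N -> N (vpair u v) -> N (vpair (f *: u) (f *: v)).
Proof.
by move=> mN /(submodule_scale f 0 mN); rewrite vpairZ mulr0 addr0.
Qed.

Definition left_kernel N : set 'rV[S]_d := [set u | N (vpair u 0)].

(** Both projections of a spanning submodule N to S^d are onto. Multiplying
    (u, v) in N by (X^m, 0) in A puts (X^m u, 0) into N. *)
Section Spanning.
Variable N : set 'rV[B]_d.
Hypotheses (mN : submodule N) (spanN : span N = setT).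

Lemma spanning_left u : exists v, N (vpair u v).
Proof.
pose L : set 'rV[B]_d := [set x | exists u v v', x = vpair u v /\ N (vpair u v')].
have [N0 ND _] := mN.
have : span N (vpair u 0) by rewrite spanN.
move=> /(_ L)[|x Nx|u' [v [v' [/vpair_inj[<- _] Nv']]]]; last by exists v'.
  split.
  - by exists 0, 0, 0; rewrite vpair0.
  - move=> _ _ [u1 [v1 [w1 [-> N1]]]] [u2 [v2 [w2 [-> N2]]]].
    exists (u1 + u2), (v1 + v2), (w1 + w2); rewrite -!vpairD; split=> //.
    exact: ND.
  - move=> b _ [u1 [v1 [w1 [-> N1]]]]; have [f [g ->]] := spairP sp b.
    exists (f *: u1), (g *: v1), (f *: w1); rewrite -vpairZ; split=> //.
    exact: submodule_scale_diag.
by have [u1 [v1 xE]] := vpairP x; exists u1, v1, v1; rewrite -xE.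
Qed.

Lemma spanning_right v : exists u, N (vpair u v).
Proof.
pose L : set 'rV[B]_d := [set x | exists u v u', x = vpair u v /\ N (vpair u' v)].
have [N0 ND _] := mN.
have : span N (vpair 0 v) by rewrite spanN.
move=> /(_ L)[|x Nx|u' [v' [w [/vpair_inj[_ <-] Nw]]]]; last by exists w.
  split.
  - by exists 0, 0, 0; rewrite vpair0.
  - move=> _ _ [u1 [v1 [w1 [-> N1]]]] [u2 [v2 [w2 [-> N2]]]].
    exists (u1 + u2), (v1 + v2), (w1 + w2); rewrite -!vpairD; split=> //.
    exact: ND.
  - move=> b _ [u1 [v1 [w1 [-> N1]]]]; have [f [g ->]] := spairP sp b.
    exists (f *: u1), (g *: v1), (g *: w1); rewrite -vpairZ; split=> //.
    exact: submodule_scale_diag.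
by have [u1 [v1 xE]] := vpairP x; exists u1, v1, u1; rewrite -xE.
Qed.

Lemma left_kernel_bounded : bounded_submodules m (left_kernel N).
Proof.
have [N0 ND _] := mN; split.
  split; rewrite /left_kernel /=.
  - by rewrite vpair0.
  - by move=> u v Nu /(ND _ _ Nu); rewrite vpairD addr0.
  - by move=> a v /(submodule_scale_diag a mN); rewrite scaler0.
move=> u; have [v Nv] := spanning_left u.
have := submodule_scale ('X ^+ m) (-1) mN Nv.
by rewrite vpairZ mulrN1 subrr scale0r.
Qed.

Lemma index_left_kernel :
  finite_set (cosets N) /\ subm_index N = subm_index (left_kernel N).
Proof.
have sN := submodule_subgroup mN; have [N0 ND _] := mN.
have bK := left_kernel_bounded.
have [mK finK] := bounded_lattice bK.
have sK := @submodule_subgroup S S idfun _ _ mK.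
have [r [_ rE rU]] := subm_indexP sK finK.
have T : coset_reps setT N (fun j => vpair (r j) 0).
  split=> // [x _|i j]; last by rewrite vpairB subr0 => /rU.
  have [u [v ->]] := vpairP x; have [u' Nu'] := spanning_right v.
  have [j Nj] := rE (u - u') I; exists j.
  have -> : vpair u v - vpair (r j) 0 = vpair u' v + vpair (u - u' - r j) 0.
    rewrite vpairB vpairD subr0 addr0; congr vpair.
    by rewrite addrA addrCA subrr addr0.
  exact: ND.
split; last by rewrite (subm_index_coset_reps sN T) card_ord.
exact: coset_reps_finite_index T.
Qed.

End Spanning.

(** The pairs (u, v) with u = v F modulo K: the graph of the linear map from S^d
    to S^d / K that is given by F. *)
Definition graph_lattice (K : set 'rV[S]_d) (F : 'M[S]_d) : set 'rV[B]_d :=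
  [set x | exists u v, x = vpair u v /\ K (u - v *m F)].

Lemma graph_latticeE K F u v : graph_lattice K F (vpair u v) <-> K (u - v *m F).
Proof.
split=> [[u' [v' [/vpair_inj[-> ->]]]] //|Kuv].
by exists u, v.
Qed.

Lemma graph_lattice_submodule K F : bounded_submodules m K ->
  submodule (graph_lattice K F).
Proof.
move=> [[K0 KD KZ] KX]; split.
- by rewrite -vpair0; apply/graph_latticeE; rewrite mul0mx subr0.
- move=> _ _ [u [v [-> Kuv]]] [u' [v' [-> Kuv']]].
  rewrite vpairD; apply/graph_latticeE; rewrite mulmxDl opprD addrACA.
  exact: KD Kuv Kuv'.
- move=> a _ [u [v [-> Kuv]]]; have [f [g ->]] := iota_pair a.
  rewrite vpairZ; apply/graph_latticeE.
  have -> : f *: u - ((f + 'X ^+ m * g) *: v) *m F =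
      f *: (u - v *m F) + 'X ^+ m *: (- (g *: (v *m F))).
    rewrite scalerDl mulmxDl -!scalemxAl scalerBr scalerN scalerA opprD addrA.
    by [].
  by apply: KD; [apply: (KZ f)|apply: KX].
Qed.

Lemma left_kernel_graph K F : left_kernel (graph_lattice K F) = K.
Proof.
by apply/seteqP; split=> u; rewrite /left_kernel /= ?graph_latticeE mul0mx subr0.
Qed.

Lemma graph_span K F : bounded_submodules m K ->
  span (graph_lattice K F) = setT <-> forall u, exists v, K (u - v *m F).
Proof.
move=> bK; have [[K0 _ _] _] := bK; split=> [spanN u|KF].
  have [v] := spanning_left (graph_lattice_submodule F bK) spanN u.
  by move=> /graph_latticeE; exists v.
apply/seteqP; split=> // x _ L [L0 LD LZ] NL.
have [u [v ->]] := vpairP x.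
have -> : vpair u v = vpair u 0 + vpair 0 v by rewrite vpairD addr0 add0r.
apply: LD.
  have [w Kw] := KF u; have := LZ (spair 1 0) (vpair u w).
  by rewrite /= vpairZ scale1r scale0r; apply; apply: NL; apply/graph_latticeE.
have := LZ (spair 0 1) (vpair (v *m F) v).
rewrite /= vpairZ scale1r scale0r; apply; apply: NL; apply/graph_latticeE.
by rewrite subrr.
Qed.

(** Nakayama: a submodule containing X^m S^d is everything once its reduction
    is. *)
Lemma bounded_nakayama (M : set 'rV[S]_d) : bounded_submodules m M ->
  (1%:M <= redspace M)%MS -> M = setT.
Proof.
move=> [mM MX] fM; have [M0 MD MZ] := mM.
have step j v : exists2 u, M u & exists w, v = u + 'X ^+ j *: w.
  elim: j => [|j [u Mu [w ->]]].
    by exists 0 => //; exists v; rewrite scale1r add0r.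
  have : (red w <= redspace M)%MS by apply: submx_trans fM; apply: submx1.
  move=> /(redspaceP _ mM)[u' Mu' uw].
  have [w' w'E] : exists w', w - u' = 'X *: w'.
    by apply: red_eq0; rewrite map_mxB uw subrr.
  exists (u + 'X ^+ j *: u'); first by apply: MD => //; apply: (MZ ('X ^+ j)).
  exists w'; rewrite exprSr -scalerA -w'E scalerBr -addrA; congr (_ + _).
  by rewrite addrCA subrr addr0.
apply/seteqP; split=> // v _; have [u Mu [w ->]] := step m v.
exact: MD.
Qed.

Section Fibre.
Variable K : set 'rV[S]_d.
Hypothesis bK : bounded_submodules m K.
Let Wc := ((redspace K)^C)%MS.
Let r := \rank Wc.
Let c := subm_index (colonX K).
Variable t : 'I_c -> 'rV[S]_d.
Hypothesis tT : coset_reps setT (colonX K) t.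

(** Rows run through representatives of S^d / K. *)
Definition rep_mx (x : 'M[k]_(d, r) * {ffun 'I_d -> 'I_c}) : 'M[S]_d :=
  map_mx (@fpsC k) (x.1 *m row_base Wc) + 'X *: \matrix_i t (x.2 i).

Let rep (y : 'rV[k]_r * 'I_c) : 'rV[S]_d :=
  map_mx (@fpsC k) (y.1 *m row_base Wc) + 'X *: t y.2.

Let repT : coset_reps setT K rep.
Proof. by have [mK _] := bK; apply: (colonX_reps mK tT). Qed.

Lemma row_rep_mx x i : row i (rep_mx x) = rep (row i x.1, x.2 i).
Proof.
rewrite /rep_mx linearD linearZ /= rowK; congr (_ + _).
by rewrite -map_row row_mul.
Qed.

Lemma red_rep_mx x : red (rep_mx x) = x.1 *m row_base Wc.
Proof.
apply/row_matrixP => i; rewrite -map_row row_rep_mx /rep map_mxD red_lift redX.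
by rewrite addr0 row_mul.
Qed.

(** The rows of F span S^d modulo K exactly when they do so modulo X, where they
    span k^d together with the image of K. *)
Lemma graph_rep_span x :
  span (graph_lattice K (rep_mx x)) = setT <-> row_full x.1.
Proof.
have [mK KX] := bK; have [K0 KD KZ] := mK.
rewrite (graph_span _ bK) -sub1mx; split=> [KF|x1].
  apply/row_subP => i; set z := row i 1%:M.
  have [v Kv] := KF (map_mx (@fpsC k) (z *m row_base Wc)).
  have : (red (map_mx (@fpsC k) (z *m row_base Wc) - v *m rep_mx x)
          <= redspace K)%MS.
    by apply/(redspaceP _ mK); eexists; [exact: Kv|].
  rewrite map_mxB red_lift /= map_mxM red_rep_mx mulmxA -mulmxBl => zK.
  have : ((z - red v *m x.1) *m row_base Wc <= redspace K :&: Wc)%MS.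
    by rewrite sub_capmx zK -(eq_row_base Wc) submxMl.
  rewrite capmx_compl submx0 mulmx_free_eq0 ?row_base_free //.
  by rewrite subr_eq0 => /eqP ->; apply: submxMl.
pose M : set 'rV[S]_d := [set u | exists v, K (u - v *m rep_mx x)].
have KM : K `<=` M by move=> u Ku; exists 0; rewrite mul0mx subr0.
have mM : Ssubmodule M.
  split; first exact: KM.
    move=> u u' [v Kv] [v' Kv']; exists (v + v').
    by rewrite mulmxDl opprD addrACA; apply: KD Kv Kv'.
  move=> a u [v Kv]; exists (a *: v).
  by rewrite -scalemxAl -scalerBr; apply: (KZ a).
suff MT : M = setT by move=> u; have : M u by rewrite MT.
apply: bounded_nakayama; first by split=> // v; apply: KM.
apply: (@submx_trans _ _ _ _ _ _ (redspace K + Wc)%MS).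
  by rewrite sub1mx addsmx_compl_full.
rewrite addsmx_sub (redspaceS mK mM KM) /=.
rewrite -(eq_row_base Wc); apply/rV_subP => y /submxP[z ->].
have /submxP[z' zE] : (z <= x.1)%MS by apply: submx_trans x1; apply: submx1.
apply/(redspaceP _ mM); exists (map_mx (@fpsC k) z' *m rep_mx x).
  by exists (map_mx (@fpsC k) z'); rewrite subrr.
by rewrite map_mxM red_lift red_rep_mx zE mulmxA.
Qed.

Definition full_data : {set 'M[k]_(d, r) * {ffun 'I_d -> 'I_c}} :=
  [set x | row_full x.1]%SET.

Lemma card_full_data :
  #|full_data| = ((subm_index K %/ #|k| ^ corank K) ^ d *
                  \prod_(j < corank K) (#|k| ^ d - #|k| ^ j))%N.
Proof.
have [mK _] := bK; have lK := bounded_lattice bK.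
have lX := colonX_lattice lK.
have [_ ->] := index_colonX mK lX.
rewrite mulKn; last by rewrite expn_gt0 (ltnW (card_finNzRing_gt1 _)).
have -> : full_data =
    finset.setX [set G | row_full G]%SET [set: {ffun 'I_d -> 'I_c}]%SET.
  by apply/finset.setP => -[G h]; rewrite !inE andbT.
rewrite finset.cardsX card_row_full cardsT card_ffun !card_ord mulnC.
by rewrite /r /Wc corankE.
Qed.

(** A matrix of representatives is determined by the class of each row, so the
    matrices of this form correspond to the linear maps to S^d / K. *)
Lemma graph_lattice_bij :
  set_bij [set` full_data]
    (spanning_lattices iota (d := d) `&` left_kernel @^-1` [set K])
    (fun x => graph_lattice K (rep_mx x)).
Proof.
have [_ repE repU] := repT; split.
- move=> x; rewrite /= inE => fx.
  have mG := graph_lattice_submodule (rep_mx x) bK.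
  have sG : span (graph_lattice K (rep_mx x)) = setT by apply/graph_rep_span.
  split; last by rewrite /= left_kernel_graph.
  by split=> //; split=> //; have [] := index_left_kernel mG sG.
- move=> [G h] [G' h'] _ _ E.
  have Ei i : (row i G, h i) = (row i G', h' i).
    apply: repU; rewrite -!(row_rep_mx (_, _)).
    have : graph_lattice K (rep_mx (G, h)) (vpair (row i (rep_mx (G, h))) (row i 1%:M)).
      by apply/graph_latticeE; rewrite -row_mul mul1mx subrr; case: bK => -[].
    by rewrite E => /graph_latticeE; rewrite -row_mul mul1mx.
  congr (_, _); first by apply/row_matrixP => i; case: (Ei i).
  by apply/ffunP => i; case: (Ei i).
- move=> N [[[mN finN] spanN] /= NK].
  have [N0 ND _] := mN.
  have hP i : exists y, N (vpair (rep y) (row i 1%:M)).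
    have [u Nu] := spanning_right mN spanN (row i 1%:M).
    have [y Ky] := repE u I; exists y.
    have := subgroupB (submodule_subgroup mN) Nu; rewrite -NK in Ky.
    by move=> /(_ _ Ky); rewrite vpairB subKr subr0.
  have [h hE] := choice hP.
  pose x : 'M[k]_(d, r) * {ffun 'I_d -> 'I_c} :=
    (\matrix_i (h i).1, [ffun i => (h i).2]).
  have rowx i : row i (rep_mx x) = rep (h i).
    by rewrite row_rep_mx /= rowK ffunE; case: (h i).
  have NF v : N (vpair (v *m rep_mx x) v).
    rewrite -{2}[v]mulmx1 !mulmx_sum_row.
    apply: (big_ind2 (fun a b => N (vpair a b))) => [|a b a' b' Na Nb|i _].
    - by rewrite vpair0.
    - by rewrite -vpairD; apply: ND.
    - by apply: submodule_scale_diag => //; rewrite rowx.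
  have NE : graph_lattice K (rep_mx x) = N.
    apply/seteqP; split=> y; have [u [v ->]] := vpairP y.
      move=> /graph_latticeE; rewrite -NK /left_kernel /= => Nuv.
      by have := ND _ _ Nuv (NF v); rewrite vpairD subrK add0r.
    move=> Nuv; apply/graph_latticeE; rewrite -NK /left_kernel /=.
    by have := subgroupB (submodule_subgroup mN) Nuv (NF v); rewrite vpairB subrr.
  exists x => //; rewrite /= inE; apply/graph_rep_span.
  by rewrite NE.
Qed.

End Fibre.

(** The number of surjections from S^d onto a quotient of index l and corank
    r. *)
Definition surjection_count r l : nat :=
  ((l %/ #|k| ^ r) ^ d * \prod_(j < r) (#|k| ^ d - #|k| ^ j))%N.

(** A spanning submodule is the graph of a surjection of S^d onto S^d / K. *)
Lemma esum_spanning (R : realType) (w : nat -> \bar R) : (forall i, 0 <= w i)%E ->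
  (\esum_(N in spanning_lattices iota (d := d)) w (subm_index N) =
   \esum_(K in @bounded_submodules k d m)
     ((surjection_count (corank K) (subm_index K))%:R%:E * w (subm_index K)))%E.
Proof.
move=> w0; rewrite (esum_fibre (p := left_kernel) (E := @bounded_submodules k d m)) //.
  apply: eq_esum => K bK; have [mK _] := bK; have lK := bounded_lattice bK.
  have lX := colonX_lattice lK.
  have sX : subgroup (colonX K) by apply: (@submodule_subgroup S S idfun); case: lX.
  have [t tT] := subm_indexP sX (proj2 lX).
  rewrite (esum_cst_finset (graph_lattice_bij bK tT) (c := w (subm_index K))) //.
    by rewrite card_full_data.
  move=> N [[[mN finN] spanN] <-].
  by have [_ ->] := index_left_kernel mN spanN.
by move=> N [[mN _] spanN]; apply: left_kernel_bounded.
Qed.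

End SpanningLattices.

(** * The normalization of k[[X, Y]] / (Y (Y - X^m)) *)

Section SingularityRing.
Local Open Scope quotient_scope.
Variables (k : finFieldType) (m : nat).
Local Notation S := {fps k}.
Local Notation "'X" := (fpsX : S) : ring_scope.
Local Notation "'Y" := (fpsX : {fps S}) : ring_scope.
Local Notation A := (R_2_2m k m).
Local Notation quotA := {ideal_quot (@sing_ideal k m)}.

Definition sing_class (f : {fps S}) : A := \pi_quotA f.

Fact sing_class_zmod : {morph sing_class : f g / f - g}.
Proof. by move=> f g; apply: (rmorphB (\pi_quotA)). Qed.
Fact sing_class_monoid : monoid_morphism sing_class.
Proof.
by split; [exact: (rmorph1 \pi_quotA)|move=> f g; exact: (rmorphM \pi_quotA)].
Qed.
HB.instance Definition _ :=
  GRing.isZmodMorphism.Build _ _ sing_class sing_class_zmod.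
HB.instance Definition _ :=
  GRing.isMonoidMorphism.Build _ _ sing_class sing_class_monoid.

Lemma sing_class_eq0 f :
  sing_class f = 0 <-> exists g, f = g * sing_rel k m.
Proof.
suff -> : sing_class f = 0 <-> f \in @sing_ideal k m by split=> /asboolP.
rewrite -[X in X \in _]subr0 Quotient.idealrBE -(raddf0 sing_class).
by split=> [E|/eqP E]; [apply/eqP|]; exact: E.
Qed.

Lemma sing_class_surj (r : A) : exists f, r = sing_class f.
Proof. by exists (repr (r : quotA)); rewrite /sing_class reprK. Qed.

Hypothesis m1 : (1 <= m)%N.

(** The value at Y = X^m of the series with coefficients f_j, f_(j+1), and so
    on: the sum of all f_(i + j) X^(m i). In degree l only the i <= l
    contribute, because m is positive. *)
Definition tail_eval (f : {fps S}) j : S :=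
  Fps (fun l => \sum_(i < l.+1) fcoef ('X ^+ (m * i) * fcoef f (i + j)) l).

Lemma tail_evalE f j : tail_eval f j = fcoef f j + 'X ^+ m * tail_eval f j.+1.
Proof.
have coefE h i l : fcoef (tail_eval h i) l =
  \sum_(n < l.+1) fcoef ('X ^+ (m * n) * fcoef h (n + i)) l by [].
apply: fpsP => l; rewrite fcoefD fcoefXnM !coefE big_ord_recl.
rewrite muln0 expr0 mul1r add0n; congr (_ + _).
under eq_bigr => i _ do rewrite lift0 mulnS exprD -mulrA fcoefXnM addSnnS.
case: ltnP => lm; first by rewrite big1.
rewrite (@big_ord_widen _ _ _ (l - m).+1 l
  (fun i => fcoef ('X ^+ (m * i) * fcoef f (i + j.+1)) (l - m)%N)).
  rewrite [RHS]big_mkcond; apply: eq_bigr => i _; case: ltnP => // li.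
  by rewrite fcoefXnM (leq_trans li) // leq_pmull.
by rewrite ltn_subrL m1 (leq_trans m1 lm).
Qed.

Lemma fcoef_sing_rel (g : {fps S}) i :
  fcoef (g * sing_rel k m) i =
  if i is j.+1 then (if j is l.+1 then fcoef g l else 0) - 'X ^+ m * fcoef g j
  else 0.
Proof.
have -> : g * sing_rel k m = 'Y * ('Y * g - fpsC ('X ^+ m) * g).
  rewrite /sing_rel /singY /singX -rmorphXn /=; ring.
by rewrite fcoefXM; case: i => // j; rewrite fcoefD fcoefN fcoefXM fcoefCM.
Qed.

Definition scalar_class (a : S) : A := sing_class (fpsC a).
HB.instance Definition _ := GRing.RMorphism.copy scalar_class
  (sing_class \o @fpsC S).

Definition y_class : A := sing_class 'Y.

(** Weierstrass division by Y (Y - X^m). *)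
Lemma sing_ring_gen (r : A) :
  exists a b, r = scalar_class a + scalar_class b * y_class.
Proof.
have [f ->] := sing_class_surj r; exists (fcoef f 0), (tail_eval f 1).
apply/eqP; rewrite -subr_eq0; apply/eqP.
rewrite /scalar_class /y_class -rmorphM -rmorphD -rmorphB; apply/sing_class_eq0.
exists (Fps (fun i => tail_eval f i.+2)); apply: fpsP => i.
rewrite fcoef_sing_rel !(fcoefD, fcoefN) [fpsC _ * _]mulrC fcoefXM.
case: i => [|[|i]] /=.
- by rewrite addr0 subrr.
- by rewrite tail_evalE; ring.
- by rewrite (tail_evalE f i.+2); ring.
Qed.

(** Comparing coefficients, a multiple g Y (Y - X^m) of degree at most 1 in Y has
    g_i = X^m g_(i+1) for all i, so that g_0 is divisible by all powers of X. *)
Lemma sing_ring_free a b :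
  scalar_class a + scalar_class b * y_class = 0 -> a = 0 /\ b = 0.
Proof.
rewrite /scalar_class /y_class -rmorphM -rmorphD => /sing_class_eq0[g E].
have Ei i := congr1 (fun h => fcoef h i) E.
have gE i : fcoef g i = 'X ^+ m * fcoef g i.+1.
  have := Ei i.+2; rewrite fcoef_sing_rel fcoefD [fpsC _ * _]mulrC fcoefXM /=.
  by rewrite addr0 => /esym/eqP; rewrite subr_eq0 => /eqP.
have g0 : fcoef g 0 = 0.
  have gN l : fcoef g 0 = 'X ^+ (m * l) * fcoef g l.
    by elim: l => [|l ->]; rewrite ?muln0 ?expr0 ?mul1r // gE mulrA -exprD mulnS addnC.
  by apply: fpsP => i; rewrite (gN i.+1) fcoefXnM leq_pmull.
split.
  by have := Ei 0%N; rewrite fcoef_sing_rel fcoefD [fpsC _ * _]mulrC fcoefXM /= addr0.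
have := Ei 1%N; rewrite fcoef_sing_rel fcoefD [fpsC _ * _]mulrC fcoefXM /=.
by rewrite g0 mulr0 subr0 add0r.
Qed.

Lemma y_class_sqr : y_class * y_class = scalar_class ('X ^+ m) * y_class.
Proof.
apply/eqP; rewrite -subr_eq0; apply/eqP.
rewrite /scalar_class /y_class -!rmorphM -rmorphB; apply/sing_class_eq0.
by exists 1; rewrite mul1r /sing_rel /singY /singX rmorphXn /=; ring.
Qed.

Lemma scalar_class_regular a : (forall f : S, a * f = 0 -> f = 0) ->
  GRing.lreg (scalar_class a).
Proof.
move=> aI; apply: mulrI0_lreg => r; have [f [g ->]] := sing_ring_gen r.
rewrite mulrDr mulrA -!rmorphM => /sing_ring_free[/aI -> /aI ->].
by rewrite !rmorph0; ring.
Qed.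

Section Normalization.
Variables (B : comNzRingType) (iota : {rmorphism A -> B}).
Hypothesis normB : is_normalization iota.

Definition scalar_map (f : S) : B := iota (scalar_class f).
HB.instance Definition _ := GRing.RMorphism.copy scalar_map
  (iota \o scalar_class).
Local Notation sigma := scalar_map.

Lemma iota_inj : injective iota.
Proof.
by have [Q [j [[jI _ _] _ _]]] := normB => a b ab; apply: jI; rewrite /= ab.
Qed.

Lemma sigmaX_regular a (b : B) : sigma ('X ^+ a) * b = 0 -> b = 0.
Proof.
have [Q [j [[_ jreg _] jI _]]] := normB.
have [|c cE] := jreg (scalar_class ('X ^+ a)).
  by apply: scalar_class_regular => f; rewrite mulrC; apply: fpsXn_regular.
move=> /(congr1 j); rewrite rmorphM rmorph0 => E; apply: jI; rewrite rmorph0.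
by rewrite -[j b]mul1r -cE mulrAC; rewrite /= in E *; rewrite E mul0r.
Qed.

(** Y / X^m is idempotent, hence integral. *)
Lemma normalization_idempotent :
  exists e : B, e * e = e /\ sigma ('X ^+ m) * e = iota y_class.
Proof.
have [Q [j [[_ jreg _] jI jint]]] := normB.
have [|c cE] := jreg (scalar_class ('X ^+ m)).
  by apply: scalar_class_regular => f; rewrite mulrC; apply: fpsXn_regular.
rewrite /= in cE.
pose eQ := j (iota y_class) * c.
have eQ2 : eQ * eQ = eQ.
  rewrite /eQ mulrACA -rmorphM -rmorphM y_class_sqr !rmorphM /=.
  by rewrite mulrACA [_ * c]mulrC mulrCA mulrA mulrA [c * _]mulrC cE mul1r.
have [|e eE] := proj1 (jint eQ).
  exists ('X^2 - polyX A).
    by rewrite monicE lead_coefDl ?lead_coefXn // size_polyN size_polyX size_polyXn.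
  rewrite rootE rmorphB /= map_polyXn map_polyX !hornerE.
  by rewrite ?expr2 eQ2 subrr.
exists e; split; apply: jI; rewrite rmorphM eE //.
by rewrite /eQ mulrCA cE mulr1.
Qed.

(** An element of B is a fraction with denominator in A; its component along
    the idempotent eps is a fraction over k[[X]]. A negative X-adic valuation
    would contradict an integral equation. *)
Lemma normalization_component (eps b : B) :
  eps * eps = eps ->
  (forall r, exists f, iota r * eps = sigma f * eps) ->
  (forall f, sigma f * eps = 0 -> f = 0) ->
  (exists r, iota r = sigma ('X ^+ m) * eps) ->
  exists f, b * eps = sigma f * eps.
Proof.
move=> idem gen free [s sE].
have [Q [j [[jI jreg jfrac] jinj jint]]] := normB.
have [a [c [creg /= jbc]]] := jfrac (j b).
have {jbc} bc : b * iota c = iota a by apply: jinj; rewrite rmorphM.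
have [gam gamE] := gen c; have [alp alpE] := gen a.
have gam0 : gam != 0.
  apply/eqP => g0; have s0 : s = 0.
    apply: creg; apply: iota_inj; rewrite !rmorphM rmorph0 mulr0 sE mulrCA gamE g0.
    by rewrite rmorph0 mul0r mulr0.
  have : sigma ('X ^+ m) * eps = 0 by rewrite -sE s0 rmorph0.
  by move=> /free/eqP; rewrite (negPf (fpsXn_neq0 _ _)).
have bgam : b * sigma gam * eps = sigma alp * eps.
  by rewrite -alpE -bc -!mulrA -gamE.
have [v [u [u' [gE uu]]]] := fps_factor gam0.
have bXv : b * sigma ('X ^+ v) * eps = sigma (alp * u') * eps.
  transitivity (b * sigma gam * eps * sigma u'); last first.
    by rewrite bgam rmorphM; ring.
  rewrite gE rmorphM; transitivity (b * sigma ('X ^+ v) * eps * sigma (u' * u)).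
    by rewrite uu rmorph1 mulr1.
  by rewrite rmorphM; ring.
have [alp0|alp0] := eqVneq alp 0.
  exists 0; rewrite rmorph0 mul0r; apply: (@sigmaX_regular v).
  by rewrite mulrA [_ * b]mulrC bXv alp0 mul0r rmorph0 mul0r.
have [w [z [z' [aE zz]]]] := fps_factor alp0.
have [vw|wv] := leqP v w.
  exists ('X ^+ (w - v) * z * u').
  apply/eqP; rewrite -subr_eq0; apply/eqP; apply: (@sigmaX_regular v).
  rewrite mulrBr !mulrA [_ * b]mulrC bXv -rmorphM aE.
  by rewrite !mulrA -exprD subnKC // subrr.
(* the case of a pole: b1 X^l acts as the identity on eps B, with l > 0 *)
pose l := (v - w)%N; have l0 : (0 < l)%N by rewrite subn_gt0.
pose mu := z' * u; pose b1 := b * sigma (mu * 'X ^+ l).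
have b1E : b1 * eps = eps.
  apply/eqP; rewrite -subr_eq0; apply/eqP; apply: (@sigmaX_regular w).
  rewrite mulrBr; apply/eqP; rewrite subr_eq0; apply/eqP.
  transitivity (b * sigma ('X ^+ v) * eps * sigma mu).
    rewrite /b1 (_ : v = (w + l)%N); last by rewrite /l subnKC // ltnW.
    by rewrite exprD !rmorphM; ring.
  rewrite bXv aE /mu.
  transitivity (sigma ('X ^+ w) * eps * sigma (u' * u) * sigma (z' * z)).
    by rewrite !rmorphM; ring.
  by rewrite uu zz rmorph1 !mulr1.
have b1X i : b1 ^+ i * eps = eps.
  by elim: i => [|i IHi]; rewrite ?expr0 ?mul1r // exprS -mulrA IHi b1E.
have [|p pmonic proot] := proj2 (jint (j b)); first by exists b.
have epsC x y : x * eps * y * eps = x * y * eps.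
  by transitivity (x * y * (eps * eps)); [ring|rewrite idem].
have [rho rhoE] := choice (fun i => gen p`_i).
pose n := (size p).-1.
have sp : size p = n.+1 by rewrite prednK // size_poly_gt0 monic_neq0.
(* the integral equation of b, multiplied by (mu X^l)^n eps *)
have : sigma (\sum_(i < n.+1) rho i * (mu * 'X ^+ l) ^+ (n - i)) * eps = 0.
  rewrite rmorph_sum mulr_suml.
  transitivity ((\sum_(i < n.+1) iota p`_i * b ^+ i) * sigma (mu * 'X ^+ l) ^+ n * eps).
    rewrite !mulr_suml; apply: eq_bigr => i _.
    have -> : sigma (mu * 'X ^+ l) ^+ n =
        sigma (mu * 'X ^+ l) ^+ (n - i) * sigma (mu * 'X ^+ l) ^+ i.
      by rewrite -exprD subnK // -ltnS.
    rewrite rmorphM rmorphXn.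
    transitivity (iota p`_i * eps * sigma (mu * 'X ^+ l) ^+ (n - i) * (b1 ^+ i * eps)).
      by rewrite b1X rhoE epsC.
    have comm (x y x' y' : B) : x * (y * (x' * y')) * eps = x * x' * (y * y') * eps.
      by ring.
    by rewrite -[RHS]comm -exprMn -/b1 -epsC !mulrA.
  suff -> : \sum_(i < n.+1) iota p`_i * b ^+ i = 0 by rewrite !mul0r.
  apply: jinj; rewrite rmorph0 rmorph_sum -[RHS](rootP proot).
  rewrite (@horner_coef_wide _ n.+1); last by rewrite -sp size_poly.
  by apply: eq_bigr => i _; rewrite coef_map rmorphM rmorphXn.
move=> /free; have rhon : rho n = 1.
  apply/eqP; rewrite -subr_eq0; apply/eqP/free; rewrite rmorphB mulrBl -rhoE.
  by have /monicP := pmonic; rewrite lead_coefE => ->; rewrite !rmorph1 subrr.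
rewrite big_ord_recr [nat_of_ord ord_max]/= subnn expr0 mulr1 rhon.
move=> /(congr1 (@fps0 k)); rewrite rmorphD rmorph_sum rmorph1 rmorph0.
rewrite big1 ?add0r; first by move/eqP; rewrite oner_eq0.
move=> i _; rewrite rmorphM rmorphXn (_ : _ (mu * 'X ^+ l) = 0).
  have lt_in : (widen_ord (leqnSn n) i < n)%N := ltn_ord i.
  by rewrite expr0n subn_eq0 leqNgt lt_in mulr0.
by rewrite -(prednK l0) exprS mulrCA; apply: fcoefXM.
Qed.

(** Along e the ring A acts through Y = X^m, and along 1 - e through Y = 0. *)
Lemma normalization_split : exists e : B,
  [/\ split_ring scalar_map e,
      forall r, exists f g, iota r = spair scalar_map e f (f + 'X ^+ m * g) &
      forall f g, exists r, iota r = spair scalar_map e f (f + 'X ^+ m * g)].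
Proof.
have [e [ee eE]] := normalization_idempotent.
have iotaE f g : iota (scalar_class f + scalar_class g * y_class) =
    spair scalar_map e f (f + 'X ^+ m * g).
  by rewrite rmorphD rmorphM -eE /spair rmorphD rmorphM /scalar_map; ring.
exists e; split; last first.
- by move=> f g; exists (scalar_class f + scalar_class g * y_class).
- by move=> r; have [f [g ->]] := sing_ring_gen r; exists f, g.
have inj f g : sigma f * (1 - e) + sigma g * e = 0 -> f = 0 /\ g = 0.
  move=> E.
  have : iota (scalar_class ('X ^+ m * f) + scalar_class (g - f) * y_class) = 0.
    rewrite iotaE /spair; transitivity (sigma ('X ^+ m) *
      (sigma f * (1 - e) + sigma g * e)); last by rewrite E mulr0.
    by rewrite !(rmorphM, rmorphD, rmorphN) /=; ring.
  rewrite -(rmorph0 iota) => /iota_inj/sing_ring_free[].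
  rewrite mulrC => /fpsXn_regular -> /eqP; rewrite subr0 => /eqP -> //.
split=> // b.
have [g gE] : exists g, b * e = sigma g * e.
  apply: normalization_component => //.
  - move=> r; have [f [g ->]] := sing_ring_gen r; rewrite iotaE.
    exists (f + 'X ^+ m * g); rewrite /spair.
    transitivity (sigma f * (e - e * e) + sigma (f + 'X ^+ m * g) * (e * e)).
      by ring.
    by rewrite ee subrr mulr0 add0r.
  - by move=> f fe; have [] := inj 0 f; rewrite // rmorph0 mul0r add0r.
  - by exists y_class.
have [f fE] : exists f, b * (1 - e) = sigma f * (1 - e).
  apply: normalization_component.
  - by transitivity (1 - e - e + e * e); [ring|rewrite ee; ring].
  - move=> r; have [f [g' ->]] := sing_ring_gen r; rewrite iotaE.
    exists f; rewrite /spair.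
    transitivity (sigma f * (1 - e - e + e * e)
                  + sigma (f + 'X ^+ m * g') * (e - e * e)).
      by ring.
    by rewrite ee; ring.
  - by move=> f fe; have [] := inj f 0; rewrite // rmorph0 mul0r addr0.
  - exists (scalar_class ('X ^+ m) - y_class).
    by rewrite rmorphB -eE /scalar_map; ring.
by exists f, g; rewrite -fE -gE; ring.
Qed.

End Normalization.
End SingularityRing.

(** * Complex sums of functions of an index *)

Section PositiveFunctionals.
Variable R : realType.
Implicit Types (A K : (nat -> R) -> \bar R) (w g h : nat -> R) (u : nat -> R[i]).

(** What the sums of w (i x) over a family x, with values in [0, +oo], have in
    common. *)
Record posfun A : Prop := PosFun {
  pf_ge0 : forall w, (forall n, 0 <= w n) -> (0 <= A w)%E;
  pf_le : forall w w', (forall n, 0 <= w n <= w' n) -> (A w <= A w')%E;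
  pfD : forall w w', (forall n, 0 <= w n) -> (forall n, 0 <= w' n) ->
    A (fun n => w n + w' n) = (A w + A w')%E;
  pfZ : forall c w, 0 <= c -> (forall n, 0 <= w n) ->
    A (fun n => c * w n) = (c%:E * A w)%E }.

Lemma posfun_esum (T : choiceType) (D : set T) (K : T -> (nat -> R) -> \bar R) :
  (forall x, posfun (K x)) -> posfun (fun w => \esum_(x in D) K x w).
Proof.
move=> Kp; split.
- by move=> w w0; apply: esum_ge0 => x _; apply: pf_ge0.
- by move=> w w' ww'; apply: le_esum => x _; apply: pf_le.
- move=> w w' w0 w'0; rewrite -esumD; try by move=> x _; apply: pf_ge0.
  by apply: eq_esum => x _; rewrite (pfD (Kp x)).
- move=> c w c0 w0; rewrite -esumZl //; last by move=> x; apply: pf_ge0.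
  by apply: eq_esum => x _; rewrite (pfZ (Kp x)).
Qed.

Lemma posfun_eval n : posfun (fun w => (w n)%:E).
Proof.
split=> [w w0|w w' ww'|w w' _ _|c w _ _]; rewrite ?lee_fin //.
by have /andP[] := ww' n.
Qed.

Lemma posfun_scale A (v : nat -> R) : (forall n, 0 <= v n) -> posfun A ->
  posfun (fun w => A (fun n => v n * w n)).
Proof.
move=> v0 Ap; split.
- by move=> w w0; apply: pf_ge0 => // n; apply: mulr_ge0.
- move=> w w' ww'; apply: pf_le => // n; have /andP[wn wn'] := ww' n.
  by rewrite mulr_ge0 // ler_wpM2l.
- move=> w w' w0 w'0; rewrite -(pfD Ap); try by move=> n; apply: mulr_ge0.
  by congr A; apply: funext => n; rewrite mulrDr.
- move=> c w c0 w0; rewrite -(pfZ Ap) //; last by move=> n; apply: mulr_ge0.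
  by congr A; apply: funext => n; rewrite mulrCA.
Qed.

Lemma posfun_comp A (f : nat -> nat) : posfun A ->
  posfun (fun w => A (fun n => w (f n))).
Proof.
move=> Ap; split=> *; [exact: pf_ge0|exact: pf_le|exact: (pfD Ap)|exact: (pfZ Ap)].
Qed.

Definition rpos g n : R := Num.max (g n) 0.
Definition rneg g n : R := Num.max (- g n) 0.

Lemma rpos_ge0 g n : 0 <= rpos g n. Proof. by rewrite le_max lexx orbT. Qed.
Lemma rneg_ge0 g n : 0 <= rneg g n. Proof. by rewrite le_max lexx orbT. Qed.
Lemma rposBneg g n : g n = rpos g n - rneg g n.
Proof. by rewrite /rpos /rneg; case: (leP (g n) 0); case: (leP (- g n) 0); lra. Qed.
Lemma rpos_le g n : rpos g n <= `|g n|.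
Proof. by rewrite ge_max ler_norm normr_ge0. Qed.
Lemma rneg_le g n : rneg g n <= `|g n|.
Proof. by rewrite ge_max normr_ge0 -normrN ler_norm. Qed.

Lemma normc_ge0 (z : R[i]) : 0 <= Normc.normc z.
Proof. by case: z => a b; apply: sqrtr_ge0. Qed.

Definition finite_on A w := (A w < +oo)%E.

Lemma finite_on_le A w w' : posfun A -> (forall n, 0 <= w n <= w' n) ->
  finite_on A w' -> finite_on A w.
Proof. by move=> Ap ww'; apply: le_lt_trans; apply: pf_le. Qed.

Lemma finite_on_fin A w : posfun A -> (forall n, 0 <= w n) -> finite_on A w ->
  A w \is a fin_num.
Proof. by move=> Ap w0 fw; rewrite ge0_fin_numE //; apply: pf_ge0. Qed.

(** The extensions of A to real and to complex functions, meaningful when A is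
    finite on the absolute value. *)
Definition rext A g : R := fine (A (rpos g)) - fine (A (rneg g)).
Definition cext A u : R[i] :=
  (rext A (fun n => complex.Re (u n)) +i* rext A (fun n => complex.Im (u n)))%C.

Definition cint A u := finite_on A (fun n => Normc.normc (u n)).
Definition rint A g := finite_on A (fun n => `|g n|).

Section Linearity.
Variables (A : (nat -> R) -> \bar R) (Ap : posfun A).

(** Any decomposition of g as a difference can replace the one into positive and
    negative parts, since g^+ + g2 = g1 + g^-. *)
Lemma rextE g g1 g2 : (forall n, 0 <= g1 n) -> (forall n, 0 <= g2 n) ->
  finite_on A g1 -> finite_on A g2 -> rint A g ->
  (forall n, g n = g1 n - g2 n) -> rext A g = fine (A g1) - fine (A g2).
Proof.
move=> g10 g20 f1 f2 fg gE.
have fp : finite_on A (rpos g).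
  by apply: finite_on_le fg => // n; rewrite rpos_ge0 rpos_le.
have fn : finite_on A (rneg g).
  by apply: finite_on_le fg => // n; rewrite rneg_ge0 rneg_le.
have E : (A (rpos g) + A g2 = A g1 + A (rneg g))%E.
  rewrite -!pfD //; try by [exact: rpos_ge0|exact: rneg_ge0].
  by congr A; apply: funext => n; have := gE n; have := rposBneg g n; lra.
move/(congr1 fine): E; rewrite !fineD ?finite_on_fin //;
  try by [exact: rpos_ge0|exact: rneg_ge0].
by rewrite /rext; lra.
Qed.

Lemma rintD g h : rint A g -> rint A h -> rint A (fun n => g n + h n).
Proof.
move=> fg fh; apply: (@finite_on_le _ _ (fun n => `|g n| + `|h n|)) => //.
  by move=> n; rewrite normr_ge0 ler_normD.
by rewrite /finite_on pfD // lte_add_pinfty.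
Qed.

Lemma rintZ c g : rint A g -> rint A (fun n => c * g n).
Proof.
move=> fg; rewrite /rint /finite_on.
rewrite (_ : (fun n => `|c * g n|) = (fun n => `|c| * `|g n|)).
  by rewrite pfZ // lte_mul_pinfty // lee_fin.
by apply: funext => n; rewrite normrM.
Qed.

Lemma rint_parts g : rint A g -> finite_on A (rpos g) /\ finite_on A (rneg g).
Proof.
move=> fg; split; apply: finite_on_le fg => // n.
  by rewrite rpos_ge0 rpos_le.
by rewrite rneg_ge0 rneg_le.
Qed.

Lemma rextD g h : rint A g -> rint A h ->
  rext A (fun n => g n + h n) = rext A g + rext A h.
Proof.
move=> fg fh; have [gp gn] := rint_parts fg; have [hp hn] := rint_parts fh.
rewrite (@rextE _ (fun n => rpos g n + rpos h n) (fun n => rneg g n + rneg h n)).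
- rewrite !pfD ?fineD ?finite_on_fin //;
    try by [exact: rpos_ge0|exact: rneg_ge0].
  by rewrite /rext; lra.
- by move=> n; rewrite addr_ge0 // rpos_ge0.
- by move=> n; rewrite addr_ge0 // rneg_ge0.
- by rewrite /finite_on pfD ?lte_add_pinfty //; exact: rpos_ge0.
- by rewrite /finite_on pfD ?lte_add_pinfty //; exact: rneg_ge0.
- exact: rintD.
- by move=> n; rewrite (rposBneg g) (rposBneg h); lra.
Qed.

Lemma rextZ c g : rint A g -> rext A (fun n => c * g n) = c * rext A g.
Proof.
move=> fg; have [gp gn] := rint_parts fg.
have pos b : 0 <= b -> finite_on A (fun n => b * rpos g n).
  move=> b0; rewrite /finite_on pfZ //; last exact: rpos_ge0.
  by rewrite lte_mul_pinfty // lee_fin.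
have neg b : 0 <= b -> finite_on A (fun n => b * rneg g n).
  move=> b0; rewrite /finite_on pfZ //; last exact: rneg_ge0.
  by rewrite lte_mul_pinfty // lee_fin.
have fA b w : 0 <= b -> (forall n, 0 <= w n) -> finite_on A w ->
    fine (A (fun n => b * w n)) = b * fine (A w).
  by move=> b0 w0 fw; rewrite pfZ // fineM // finite_on_fin.
have [c0|c0] := leP 0 c.
  rewrite (@rextE _ (fun n => c * rpos g n) (fun n => c * rneg g n));
    try by [move=> n; rewrite mulr_ge0 ?rpos_ge0 ?rneg_ge0|exact: rintZ
           |exact: pos|exact: neg].
    by rewrite !fA // -?mulrBr; [|exact: rneg_ge0|exact: rpos_ge0].
  by move=> n; rewrite [in LHS](rposBneg g) mulrBr.
have c0' : 0 <= - c by rewrite oppr_ge0 ltW.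
rewrite (@rextE _ (fun n => - c * rneg g n) (fun n => - c * rpos g n));
  try by [move=> n; rewrite mulr_ge0 ?rpos_ge0 ?rneg_ge0|exact: rintZ
         |exact: pos|exact: neg].
  rewrite !fA //; [by rewrite /rext; ring|exact: rpos_ge0|exact: rneg_ge0].
by move=> n; rewrite [in LHS](rposBneg g); ring.
Qed.

Lemma normc_Re (z : R[i]) : `|complex.Re z| <= Normc.normc z.
Proof.
by case: z => a b /=; rewrite -sqrtr_sqr ler_wsqrtr // lerDl sqr_ge0.
Qed.

Lemma normc_Im (z : R[i]) : `|complex.Im z| <= Normc.normc z.
Proof.
by case: z => a b /=; rewrite -sqrtr_sqr ler_wsqrtr // lerDr sqr_ge0.
Qed.

Lemma cint_Re u : cint A u -> rint A (fun n => complex.Re (u n)).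
Proof. by apply: finite_on_le => // n; rewrite normr_ge0 normc_Re. Qed.

Lemma cint_Im u : cint A u -> rint A (fun n => complex.Im (u n)).
Proof. by apply: finite_on_le => // n; rewrite normr_ge0 normc_Im. Qed.

Lemma cextZ z u : cint A u -> cext A (fun n => z * u n) = z * cext A u.
Proof.
move=> fu; have fr := cint_Re fu; have fi := cint_Im fu.
case: z => a b; rewrite /cext.
have -> : (fun n => complex.Re ((a +i* b)%C * u n)) =
    (fun n => a * complex.Re (u n) + - b * complex.Im (u n)).
  by apply: funext => n; case: (u n) => x y /=; ring.
have -> : (fun n => complex.Im ((a +i* b)%C * u n)) =
    (fun n => a * complex.Im (u n) + b * complex.Re (u n)).
  by apply: funext => n; case: (u n) => x y /=; ring.
rewrite !rextD ?rextZ //; try exact: rintZ.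
by apply/eqP; rewrite eq_complex /=; apply/andP; split; apply/eqP; ring.
Qed.

End Linearity.

Lemma rint_parts_fin A g : posfun A -> rint A g ->
  A (rpos g) \is a fin_num /\ A (rneg g) \is a fin_num.
Proof.
move=> Ap /(rint_parts Ap)[gp gn].
by split; apply: finite_on_fin => //; [exact: rpos_ge0|exact: rneg_ge0].
Qed.

Lemma cext_add A A1 A2 u : posfun A1 -> posfun A2 ->
  (forall w, (forall n, 0 <= w n) -> A w = (A1 w + A2 w)%E) ->
  cint A1 u -> cint A2 u -> cext A u = cext A1 u + cext A2 u.
Proof.
move=> A1p A2p AE f1 f2.
have main g : rint A1 g -> rint A2 g -> rext A g = rext A1 g + rext A2 g.
  move=> g1 g2; have [p1 n1] := rint_parts_fin A1p g1.
  have [p2 n2] := rint_parts_fin A2p g2.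
  rewrite /rext !AE ?fineD //; try by [exact: rpos_ge0|exact: rneg_ge0].
  by lra.
rewrite /cext !main; try by [exact: cint_Re|exact: cint_Im].
by [].
Qed.

Lemma cext_sum (T : Type) (s : seq T) (A : (nat -> R) -> \bar R)
    (c : T -> nat) (K : T -> (nat -> R) -> \bar R) u :
  (forall x, posfun (K x)) ->
  (forall w, (forall n, 0 <= w n) ->
    A w = (\sum_(x <- s) ((c x)%:R%:E * K x w))%E) ->
  (forall x, cint (K x) u) -> cext A u = \sum_(x <- s) (c x)%:R * cext (K x) u.
Proof.
move=> Kp AE fK.
have main g : (forall x, rint (K x) g) ->
    rext A g = \sum_(x <- s) (c x)%:R * rext (K x) g.
  move=> gK; rewrite /rext !AE; try by [exact: rpos_ge0|exact: rneg_ge0].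
  have fin x := rint_parts_fin (Kp x) (gK x).
  rewrite -!sum_fine; try by move=> x _; have [? ?] := fin x; rewrite fin_numM.
  rewrite -sumrB; apply: eq_bigr => x _; have [? ?] := fin x.
  by rewrite !fineM //= mulrBr.
rewrite /cext !main; try by move=> x; first [exact: cint_Re|exact: cint_Im].
elim: s {AE main} => [|x s IHs]; first by rewrite !big_nil.
rewrite !big_cons -IHs -[_%:R in RHS](rmorph_nat (real_complex R)) /=.
by apply/eqP; rewrite eq_complex /=; apply/andP; split; apply/eqP; ring.
Qed.

Lemma cext_eq A A' u :
  (forall w, (forall n, 0 <= w n) -> A w = A' w) -> cext A u = cext A' u.
Proof.
move=> AE; have main g : rext A g = rext A' g.
  by rewrite /rext !AE //; [exact: rneg_ge0|exact: rpos_ge0].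
by rewrite /cext !main.
Qed.

Lemma cext_eval n u : cext (fun w => (w n)%:E) u = u n.
Proof. by rewrite /cext /rext /= -!rposBneg; case: (u n). Qed.

(** ** Geometric sums *)

Section Geometric.
Variables (q : nat) (K : (nat -> R) -> \bar R).
Hypothesis Kp : posfun K.

Definition geometric_sum w : \bar R :=
  \esum_(a in [set: nat]) K (fun n => w (q ^ a * n)%N).

Lemma posfun_geometric : posfun geometric_sum.
Proof. by apply: posfun_esum => a; apply: posfun_comp. Qed.

Lemma geometric_sumE w : (forall n, 0 <= w n) ->
  geometric_sum w = (K w + geometric_sum (fun n => w (q * n)%N))%E.
Proof.
move=> w0; rewrite /geometric_sum (esumID [set 0%N]); last by move=> *; apply: pf_ge0.
rewrite setTI esum_set1; last exact: pf_ge0.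
congr (_ + _)%E; first by congr K; apply: funext => n; rewrite mul1n.
rewrite (reindex_esum [set: nat] _ S).
  apply: eq_esum => a _; congr K; apply: funext => n.
  by rewrite expnS -mulnA.
split=> [a _ //|a b _ _ [] //|[|a] [_ /=] //].
by exists a.
Qed.

Variables (u : nat -> R[i]) (t : R[i]).
Hypothesis uq : forall n, u (q * n)%N = t * u n.

Lemma cint_geometric : cint geometric_sum u -> cint K u.
Proof.
rewrite /cint /finite_on geometric_sumE; last by move=> n; apply: normc_ge0.
by apply: le_lt_trans; rewrite leeDl // pf_ge0 //; [exact: posfun_geometric|
  move=> n; apply: normc_ge0].
Qed.

(** The geometric sum is K w plus the same sum for w (q n), and on u the second
    one is t times the first. *)
Lemma cext_geometric : cint geometric_sum u ->
  (1 - t) * cext geometric_sum u = cext K u.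
Proof.
move=> fu; have fK := cint_geometric fu.
have fq : cint geometric_sum (fun n => u (q * n)%N).
  rewrite /cint /finite_on; move: fu; rewrite /cint /finite_on geometric_sumE;
    last by move=> n; apply: normc_ge0.
  by apply: le_lt_trans; rewrite leeDr // pf_ge0 // => n; apply: normc_ge0.
have E : cext geometric_sum u = cext K u + t * cext geometric_sum u.
  rewrite -(cextZ posfun_geometric) // -(funext uq).
  rewrite -[X in _ + X]/(cext (fun w => geometric_sum (fun n => w (q * n)%N)) u).
  apply: cext_add => //; first by apply: posfun_comp; apply: posfun_geometric.
  exact: geometric_sumE.
by rewrite mulrBl mul1r {1}E addrK.
Qed.

Lemma geometric_finite : 0 <= Normc.normc t < 1 -> cint K u -> cint geometric_sum u.
Proof.
move=> /andP[t0 t1] fK; rewrite /cint /finite_on /geometric_sum.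
set tau := Normc.normc t in t0 t1.
have -> : \esum_(a in [set: nat]) K (fun n => Normc.normc (u (q ^ a * n)%N)) =
   (\esum_(a in [set: nat]) (fine (K (fun n => Normc.normc (u n))))%:E * (tau ^+ a)%:E)%E.
  apply: eq_esum => a _.
  rewrite fineK ?finite_on_fin //; last by move=> n; apply: normc_ge0.
  rewrite muleC -(pfZ Kp) ?exprn_ge0 //; last by move=> n; apply: normc_ge0.
  congr K; apply: funext => n; elim: a n => [|a IHa] n; first by rewrite mul1n mul1r.
  by rewrite expnS -mulnA uq Normc.normcM IHa exprS mulrA.
rewrite esumZl; last 2 first.
- by apply: fine_ge0; apply: pf_ge0 => // n; apply: normc_ge0.
- by move=> a; rewrite lee_fin exprn_ge0.
apply: lte_mul_pinfty => //; rewrite ?lee_fin.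
  by apply: fine_ge0; apply: pf_ge0 => // n; apply: normc_ge0.
rewrite -nneseries_esumT; last by move=> a; rewrite lee_fin exprn_ge0.
apply: (@le_lt_trans _ _ (1 / (1 - tau))%:E); last by rewrite ltry.
apply: lime_le; first by apply: is_cvg_nneseries => a _ _; rewrite lee_fin exprn_ge0.
apply: nearW => n; rewrite sumEFin lee_fin.
have [->|tau0] := eqVneq tau 0.
  rewrite subr0 divr1; case: n => [|n]; first by rewrite big_geq.
  by rewrite big_nat_recl // expr0 big1 ?addr0 // => i _; rewrite expr0n.
have := @geometric_le_lim R n 1 tau ler01; rewrite lt0r tau0 t0 ger0_norm //.
move=> /(_ isT t1); rewrite /series /geometric /=.
by under eq_bigr do rewrite mul1r.
Qed.

End Geometric.
End PositiveFunctionals.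

(** * The zeta functions *)

Section ComplexPowers.
Variable R : realType.
Implicit Types (a b : R) (z s : R[i]).

Lemma cpowM a b z : 0 < a -> 0 < b -> cpow (a * b) z = cpow a z * cpow b z.
Proof.
move=> a0 b0; rewrite /cpow lnM ?posrE // !mulrDr expRD cosD sinD.
by apply/eqP; rewrite eq_complex /=; apply/andP; split; apply/eqP; ring.
Qed.

Lemma cpowD a z z' : cpow a (z + z') = cpow a z * cpow a z'.
Proof.
case: z z' => [x y] [x' y']; rewrite /cpow /= !mulrDl expRD cosD sinD.
by apply/eqP; rewrite eq_complex /=; apply/andP; split; apply/eqP; ring.
Qed.

Lemma cpow_id a : 0 < a -> cpow a 1 = a%:C%C.
Proof.
move=> a0; rewrite /cpow /= mul1r mul0r cos0 sin0 lnK ?posrE //.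
by rewrite mulr1 mulr0.
Qed.

Lemma cpow1 z : cpow 1 z = 1 :> R[i].
Proof. by rewrite /cpow ln1 !mulr0 expR0 cos0 sin0 mulr1 mulr0. Qed.

Lemma normc_cpow a z : Normc.normc (cpow a z) = expR (complex.Re z * ln a).
Proof.
rewrite /cpow /= !exprMn -mulrDr cos2Dsin2 mulr1 sqrtr_sqr ger0_norm //.
Qed.

(** The term n^(-s) of a Dirichlet series; the value at 0 makes it completely
    multiplicative. *)
Definition dterm s (n : nat) : R[i] := if n == 0%N then 0 else cpow n%:R (- s).

Lemma dtermM s n l : dterm s (n * l) = dterm s n * dterm s l.
Proof.
rewrite /dterm muln_eq0; case: eqVneq => [_|n0]; first by rewrite mul0r.
case: eqVneq => [_|l0]; first by rewrite mulr0.
by rewrite natrM cpowM // ltr0n lt0n.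
Qed.

Lemma dterm1 s : dterm s 1 = 1. Proof. by rewrite /dterm cpow1. Qed.

Lemma dtermX s n l : dterm s (n ^ l) = dterm s n ^+ l.
Proof. by elim: l => [|l IHl]; rewrite ?dterm1 // expnS dtermM IHl exprS. Qed.

Lemma dterm_shift s n : n%:R * dterm s n = dterm (s - 1) n.
Proof.
rewrite /dterm; case: eqVneq => [_|n0]; first by rewrite mulr0.
rewrite opprB addrC cpowD cpow_id ?ltr0n ?lt0n // mulrC; congr (_ * _).
by rewrite -(rmorph_nat (real_complex R)).
Qed.

Lemma normc_natM n z : Normc.normc (n%:R * z) = n%:R * Normc.normc z.
Proof.
rewrite Normc.normcM -(rmorph_nat (real_complex R)) /= expr0n addr0 sqrtr_sqr.
by rewrite ger0_norm.
Qed.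

Lemma normc_dterm_lt1 s n : (1 < n)%N -> 0 < complex.Re s ->
  0 <= Normc.normc (dterm s n) < 1.
Proof.
move=> n1 s0; rewrite normc_ge0.
have -> : dterm s n = cpow n%:R (- s) by rewrite /dterm; case: (n) n1.
rewrite normc_cpow andTb.
rewrite expR_lt1; case: s s0 => x y /= x0; rewrite mulNr oppr_lt0.
by rewrite mulr_gt0 // ln_gt0 // ltr1n.
Qed.

End ComplexPowers.

(** The sum over a family of indexed submodules as a positive functional. *)
Definition index_sum (R : realType) (B : comNzRingType) d
    (D : set (set 'rV[B]_d)) (w : nat -> R) : \bar R :=
  (\esum_(N in D) (w (subm_index N))%:E)%E.

Lemma posfun_index_sum (R : realType) (B : comNzRingType) d
    (D : set (set 'rV[B]_d)) : posfun (@index_sum R B d D).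
Proof. by apply: posfun_esum => N; apply: posfun_eval. Qed.

Section ZetaSums.
Variables (R : realType) (A B : comNzRingType) (iota : {rmorphism A -> B}) (d : nat).
Local Notation lattices := (@finite_index_submodules A B iota d).

Lemma zeta_termE s (N : set 'rV[B]_d) :
  lattices N -> zeta_term s N = dterm s (subm_index N) :> R[i].
Proof.
move=> [mN finN]; have := subm_index_gt0 (submodule_subgroup mN) finN.
by rewrite /zeta_term /dterm; case: (subm_index N).
Qed.

Lemma zeta_cvgE (s : R[i]) : zeta_cvg iota d s <-> cint (index_sum lattices) (dterm s).
Proof.
rewrite /zeta_cvg /csummable /summable /cint /finite_on /index_sum.
rewrite (eq_esum (b := fun N => (Normc.normc (dterm s (subm_index N)))%:E)) //.
by move=> N lN; rewrite zeta_termE //= ger0_norm // normc_ge0.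
Qed.

Lemma zetaE (s : R[i]) : zeta iota d s = cext (index_sum lattices) (dterm s).
Proof.
have main (f : R[i] -> R) :
    rsum lattices (fun N => f (zeta_term s N)) =
    rext (index_sum lattices) (fun n => f (dterm s n)).
  rewrite /rsum /rext /index_sum; congr (fine _ - fine _); apply: eq_esum => N lN;
    by rewrite ?funeposE ?funenegE /= zeta_termE // /rpos /rneg -?EFinN EFin_max.
by rewrite /zeta /csum /cext !main.
Qed.

End ZetaSums.

(** ** The zeta function of the product of two power series rings *)

Section SplitZeta.
Variables (R : realType) (k : finFieldType) (B : comNzRingType).
Variables (sigma : {rmorphism {fps k} -> B}) (e : B).
Hypothesis sp : split_ring sigma e.
Local Notation q := #|k|.
Local Notation lattices d := (@finite_index_submodules B B idfun d).

Lemma lattices0 : lattices 0 = [set setT].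
Proof.
apply/seteqP; split=> [L [[L0 _ _] _]|_ ->].
  by apply/seteqP; split=> // v _; rewrite [v]thinmx0.
split=> //; apply: (cover_finite_index (c := fun _ : 'I_1 => 0)) => // v _.
by exists ord0.
Qed.

Lemma subm_index0 : subm_index [set: 'rV[B]_0] = 1%N.
Proof.
have T : coset_reps setT [set: 'rV[B]_0] (fun _ : 'I_1 => 0).
  by split=> // [v _|i j _]; [exists ord0|rewrite !ord1].
by rewrite (subm_index_coset_reps (@subgroupT _) T) card_ord.
Qed.

Lemma index_sum0 (w : nat -> R) : (forall n, 0 <= w n) ->
  index_sum (lattices 0) w = (w 1%N)%:E.
Proof. by move=> w0; rewrite /index_sum lattices0 esum_set1 ?subm_index0 ?lee_fin. Qed.

Definition twisted_sum d (w : nat -> R) : \bar R :=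
  index_sum (lattices d) (fun n => n%:R * w n).

Lemma posfun_twisted d : posfun (twisted_sum d).
Proof. by apply: posfun_scale => //; apply: posfun_index_sum. Qed.

(** The ideals of B are indexed by two exponents a and b, and there are as many
    classes modulo L as the index of L, which accounts for the weight n in
    twisted_sum. *)
Lemma index_sumS d (w : nat -> R) : (forall n, 0 <= w n) ->
  index_sum (lattices d.+1) w = geometric_sum q (geometric_sum q (twisted_sum d)) w.
Proof.
move=> w0; rewrite /index_sum.
rewrite (esum_latticesS (split_principal_system sp) d (f := fun n => (w n)%:E)) //.
rewrite /geometric_sum [RHS]esum_esum; last first.
  by move=> a b _ _; apply: (pf_ge0 (posfun_twisted d)).
have -> : [set: nat] `*`` (fun _ => [set: nat]) = [set: nat * nat].
  by apply/seteqP; split.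
apply: eq_esum => -[a b] _; apply: eq_esum => L _ /=.
by rewrite -EFinM mulnA -expnD.
Qed.

Lemma cint_twisted d (s : R[i]) : cint (twisted_sum d) (dterm s) <->
  cint (index_sum (lattices d)) (dterm (s - 1)).
Proof.
rewrite /cint /finite_on /twisted_sum.
suff -> : (fun n => n%:R * Normc.normc (dterm s n)) =
          (fun n => Normc.normc (dterm (s - 1) n)) by [].
by apply: funext => n; rewrite -normc_natM dterm_shift.
Qed.

Lemma cext_twisted d (s : R[i]) : cext (twisted_sum d) (dterm s) =
  cext (index_sum (lattices d)) (dterm (s - 1)).
Proof.
have part (f : R[i] -> R) : (forall n z, f (n%:R * z) = n%:R * f z) ->
    rext (twisted_sum d) (fun n => f (dterm s n)) =
    rext (index_sum (lattices d)) (fun n => f (dterm (s - 1) n)).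
  move=> fM; rewrite /rext /twisted_sum; congr (fine _ - fine _); congr index_sum;
    apply: funext => n; rewrite /rpos /rneg -dterm_shift fM.
    by rewrite maxr_pMr ?mulr0 // ler0n.
  by rewrite maxr_pMr ?mulr0 ?mulrN // ler0n.
by rewrite /cext !part // => n [x y];
  rewrite -(rmorph_nat (real_complex R)) /=; ring.
Qed.

Lemma dterm_q (s : R[i]) n : dterm s (q * n) = dterm s q * dterm s n.
Proof. exact: dtermM. Qed.

Lemma q_gt1 : (1 < q)%N. Proof. exact: card_finNzRing_gt1. Qed.

Lemma split_zeta_cvg d (s : R[i]) : d%:R - 1 < complex.Re s ->
  cint (index_sum (lattices d)) (dterm s).
Proof.
elim: d s => [|d IHd] s ds.
  rewrite /cint /finite_on index_sum0 ?ltry // => n; exact: normc_ge0.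
rewrite /cint /finite_on index_sumS; last by move=> n; apply: normc_ge0.
have s0 : 0 < complex.Re s.
  by apply: le_lt_trans ds; rewrite -natr1 addrK ler0n.
have tau := normc_dterm_lt1 q_gt1 s0.
apply: (geometric_finite (posfun_geometric q (posfun_twisted d)) (dterm_q s) tau).
apply: (geometric_finite (posfun_twisted d) (dterm_q s) tau).
apply/cint_twisted/IHd; case: s ds {s0 tau} => x y /=.
by rewrite -natr1 addrK ltrD2r.
Qed.

(** By the Euler factor (1 - q^-s)^2 relating ranks d + 1 and d, the zeta
    function is nonzero wherever it converges. *)
Lemma split_zeta_neq0 d (s : R[i]) : cint (index_sum (lattices d)) (dterm s) ->
  cext (index_sum (lattices d)) (dterm s) != 0.
Proof.
elim: d s => [|d IHd] s fs.
  rewrite (cext_eq (A' := fun w => (w 1%N)%:E)); last exact: index_sum0.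
  by rewrite cext_eval dterm1 oner_neq0.
have E := cext_eq (dterm s) (@index_sumS d).
rewrite E; have : cint (geometric_sum q (geometric_sum q (twisted_sum d))) (dterm s).
  move: fs; rewrite /cint /finite_on index_sumS //.
  by move=> n; apply: normc_ge0.
move=> f2; have Tp := posfun_twisted d; have Gp := posfun_geometric q Tp.
have f1 := cint_geometric Gp f2.
have f0 := cint_geometric Tp f1.
have := IHd _ (proj1 (cint_twisted d s) f0).
rewrite -cext_twisted -(cext_geometric Tp (dterm_q s) f1).
rewrite -(cext_geometric Gp (dterm_q s) f2).
by rewrite !mulf_eq0 !negb_or => /andP[_ /andP[]].
Qed.

End SplitZeta.

(** * The quotient of the zeta functions *)

Lemma finite_box m d : finite_set (box m d).
Proof.
elim: m => [|m IHm]; first by rewrite box0; apply: finite_set1.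
have [_ _ surj] := add_column_bij m d.
apply: (sub_finite_set surj); apply: finite_image.
apply: (@sub_finite_set _ _ (box m d `*` `I_d.+1)).
  by move=> [mu r] /= [bmu /andP[_ rd]]; split.
by apply: finite_setX => //; apply: finite_II.
Qed.

Section Quotient.
Variables (R : realType) (k : finFieldType) (A B : comNzRingType).
Variables (iota : {rmorphism A -> B}) (sigma : {rmorphism {fps k} -> B}) (e : B).
Variables (m d : nat).
Hypothesis sp : split_ring sigma e.
Local Notation "'X" := (fpsX : {fps k}) : ring_scope.
Hypothesis iota_pair :
  forall a, exists f g, iota a = spair sigma e f (f + 'X ^+ m * g).
Hypothesis pair_iota :
  forall f g, exists a, iota a = spair sigma e f (f + 'X ^+ m * g).
Local Notation q := #|k|.
Local Notation Alattices := (@finite_index_submodules A B iota d).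
Local Notation Blattices := (@finite_index_submodules B B idfun d).

(** The number of submodules N that generate B^d for which S^d / K has type mu,
    where K is the set of u with (u, 0) in N. *)
Definition spanning_count (mu : seq nat) : nat :=
  (type_count k d m mu *
   surjection_count k d (conj_part mu 1) (q ^ sumn mu))%N.

Lemma index_sum_quotient (w : nat -> R) : (forall n, 0 <= w n) ->
  index_sum Alattices w =
  (\sum_(mu <- fset_set (box m d))
     ((spanning_count mu)%:R%:E *
      index_sum Blattices (fun n => w (q ^ sumn mu * n)%N)))%E.
Proof.
move=> w0; rewrite /index_sum.
rewrite (esum_by_span iota (split_principal_system sp) d (w := fun n => (w n)%:E)) //.
pose F (L : set 'rV[B]_d) mu : \bar R :=
  ((spanning_count mu)%:R%:E * (w (q ^ sumn mu * subm_index L)%N)%:E)%E.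
transitivity (\esum_(L in Blattices) \sum_(mu <- fset_set (box m d)) F L mu)%E.
  apply: eq_esum => L _.
  rewrite (esum_spanning d sp iota_pair pair_iota
    (w := fun n => (w (subm_index L * n)%N)%:E)); last first.
    by move=> n; rewrite lee_fin.
  rewrite (esum_bounded k d m (f := fun r l =>
    ((surjection_count k d r l)%:R%:E * (w (subm_index L * l)%N)%:E)%E)); last first.
    by move=> r l; rewrite mule_ge0 ?lee_fin.
  rewrite esum_fset; last 2 first.
  - exact: finite_box.
  - by move=> mu _; rewrite !mule_ge0 ?lee_fin.
  rewrite fsbig_finite /=; last exact: finite_box.
  apply: eq_bigr => mu _; rewrite /F /spanning_count natrM EFinM -!muleA.
  by rewrite [(subm_index L * _)%N]mulnC.
rewrite (@esum_sum _ _ _ Blattices _ xpredT F); last first.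
  by move=> *; rewrite mule_ge0 ?lee_fin.
apply: eq_bigr => mu _; rewrite /F esumZl //.
by move=> L; rewrite lee_fin.
Qed.

Lemma cint_scaled (s : R[i]) n : cint (index_sum Blattices) (dterm s) ->
  cint (index_sum Blattices) (fun l => dterm s (n * l)).
Proof.
rewrite /cint /finite_on => fs.
rewrite (_ : (fun l => _) =
  (fun l => Normc.normc (dterm s n) * Normc.normc (dterm s l))); last first.
  by apply: funext => l; rewrite dtermM Normc.normcM.
rewrite (pfZ (posfun_index_sum _ _)) ?normc_ge0 //.
  by apply: lte_mul_pinfty; rewrite // lee_fin normc_ge0.
by move=> l; apply: normc_ge0.
Qed.

Lemma zeta_cvg_quotient (s : R[i]) :
  cint (index_sum Blattices) (dterm s) -> cint (index_sum Alattices) (dterm s).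
Proof.
move=> fs; rewrite /cint /finite_on index_sum_quotient; last first.
  by move=> n; apply: normc_ge0.
apply: lte_sum_pinfty => mu _; apply: lte_mul_pinfty; rewrite ?lee_fin //.
exact: cint_scaled.
Qed.

Lemma zeta_quotient (s : R[i]) : cint (index_sum Blattices) (dterm s) ->
  cext (index_sum Alattices) (dterm s) =
  (\sum_(mu <- fset_set (box m d))
     (spanning_count mu)%:R * dterm s q ^+ sumn mu) *
  cext (index_sum Blattices) (dterm s).
Proof.
move=> fs.
rewrite (cext_sum (s := fset_set (box m d)) (c := spanning_count)
  (K := fun mu w => index_sum Blattices (fun n => w (q ^ sumn mu * n)%N))).
- rewrite mulr_suml; apply: eq_bigr => mu _; rewrite -mulrA; congr (_ * _).
  rewrite -dtermX -(cextZ (posfun_index_sum _ _)) //.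
  rewrite -[LHS]/(cext (index_sum Blattices) (fun n => dterm s (q ^ sumn mu * n))).
  by congr cext; apply: funext => n; rewrite dtermM.
- by move=> mu; apply: posfun_comp; apply: posfun_index_sum.
- exact: index_sum_quotient.
- by move=> mu; apply: cint_scaled.
Qed.

(** The number of surjections onto S^d / K is
    q^(d |mu|) (1 - q^-d) ... (1 - q^-(d - mu'_1 + 1)). *)
Lemma spanning_countE (F : numFieldType) mu : box m d mu ->
  (spanning_count mu)%:R =
  skew_hall (nseq d m) mu (q%:R : F)
  * (qpoch q%:R^-1 q%:R^-1 d / qpoch q%:R^-1 q%:R^-1 (d - conj_part mu 1)%N)
  * (q%:R ^+ d) ^+ sumn mu.
Proof.
move=> bmu; rewrite /spanning_count natrM (type_countE k F bmu) -mulrA.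
congr (_ * _); set r := conj_part mu 1.
have [/andP[_ mu0] _ _] := proj1 (boxP m d mu) bmu.
have rs : (r <= sumn mu)%N by rewrite /r conj_part1 // size_partition_le.
have rd : (r <= d)%N by apply: conj_part_le bmu.
rewrite /surjection_count -expnB //; last exact/ltnW/q_gt1.
rewrite natrM !natrX (frames_qpoch k F 0 rd) add0n mulrA mulrC; congr (_ * _).
by rewrite -!exprM -exprD; congr (_ ^+ _); nia.
Qed.

End Quotient.

Theorem proposition9p6 (R : realType) (k : finFieldType) (m d : nat)
    (Rtilde : comNzRingType) (iota : {rmorphism R_2_2m k m -> Rtilde}) :
  (1 <= m)%N -> is_normalization iota ->
  (forall s : R[i], d%:R - 1 < complex.Re s ->
     zeta_cvg iota d s /\ zeta_cvg (idfun : Rtilde -> Rtilde) d s) /\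
  (forall s : R[i],
     zeta_cvg iota d s -> zeta_cvg (idfun : Rtilde -> Rtilde) d s ->
     let q : R[i] := #|k|%:R in
     let t : R[i] := cpow #|k|%:R (- s) in
     zeta (idfun : Rtilde -> Rtilde) d s != 0 /\
     nu iota d s =
       \sum_(mu \in [set mu | is_partition mu /\ contained mu (nseq d m)])
          skew_hall (nseq d m) mu q
          * (qpoch q^-1 q^-1 d / qpoch q^-1 q^-1 (d - conj_part mu 1)%N)
          * (q ^+ d * t) ^+ sumn mu).
Proof.
move=> m1 normB; have [e [sp iota_pair pair_iota]] := normalization_split m1 normB.
have zetaB := @zetaE R Rtilde Rtilde idfun d.
have cvgB := @zeta_cvgE R Rtilde Rtilde idfun d.
split=> [s ds|s _ /cvgB fs q t].
  have fs := split_zeta_cvg sp ds; split; last exact/cvgB.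
  exact/zeta_cvgE/(zeta_cvg_quotient sp iota_pair pair_iota).
have z0 := split_zeta_neq0 sp fs.
split; first by rewrite zetaB.
rewrite /nu zetaE zetaB (zeta_quotient sp iota_pair pair_iota fs) mulfK //.
rewrite -[X in \sum_(mu \in X) _]/(box m d) fsbig_finite /=; last exact: finite_box.
apply: eq_big_seq => mu; rewrite in_fset_set; last exact: finite_box.
move=> /set_mem bmu.
have -> : dterm s #|k| = t by have := q_gt1 k; rewrite /dterm /t; case: #|k|.
by rewrite (spanning_countE k _ bmu) exprMn [RHS]mulrA.
Qed.
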